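(* Let $K$ be a local field of characteristic $p>2$ and let $G$ be a finite nonabelian $p$-group. Then there is a totally ramified Galois extension $L/K$ with $\mathrm{Gal}(L/K)\cong G$ which has an upper ramification break that is not an integer.
   Context: A local field means a field complete with respect to a discrete valuation, with perfect residue field (not necessarily finite). For a finite totally ramified Galois extension $L/K$ of degree $mp^n$ with $p\nmid m$ and $G=\mathrm{Gal}(L/K)$: $v_L$ is the normalized valuation of $L$, $\pi_L$ a uniformizer, $i(\sigma)=v_L(\sigma(\pi_L)-\pi_L)-1$ for $\sigma\ne\mathrm{id}$, $G_x=\{\sigma: i(\sigma)\ge x\}$. A positive integer $b$ is a lower break of multiplicity $d\ge1$ if $|G_b:G_{b+1}|=p^d$; the positive lower breaks with multiplicity are $b_1\le\cdots\le b_n$. The upper breaks are $0$ (iff $m>1$) and $u_1\le\cdots\le u_n$ with $u_1=b_1/m$, $u_{i+1}-u_i=(b_{i+1}-b_i)/(mp^i)$. *)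

(* Defs.v *)
From HB Require Import structures.
From mathcomp Require Import all_boot all_order all_algebra.
From mathcomp Require Import all_fingroup all_solvable all_field.

Set Implicit Arguments.
Unset Strict Implicit.
Unset Printing Implicit Defensive.

Import Order.TTheory GRing.Theory Num.Theory.
Local Open Scope ring_scope.

(* Normalized discrete valuations v : K^* ->> int. The value of dval_fun at 0  *)
(* is junk (0 has valuation +oo): use val_ge v n x for "v(x) >= n".            *)
Record discrete_valuation (K : fieldType) := DiscreteValuation {
  dval_fun :> K -> int;
  dvalM : forall x y : K, x != 0 -> y != 0 ->
    dval_fun (x * y) = dval_fun x + dval_fun y;
  dvalD : forall x y : K, x != 0 -> y != 0 -> x + y != 0 ->
    Num.min (dval_fun x) (dval_fun y) <= dval_fun (x + y);
  dval_surj : exists2 x : K, x != 0 & dval_fun x = 1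
}.

Definition val_ge (K : fieldType) (v : discrete_valuation K) (n : int) (x : K) :=
  (x == 0) || (n <= v x).

Section ValuationRing.
Variables (K : fieldType) (v : discrete_valuation K).

Lemma dval1 : v 1 = 0.
Proof.
have := dvalM v (oner_neq0 K) (oner_neq0 K).
by rewrite mulr1 => /eqP; rewrite -subr_eq subrr => /eqP.
Qed.

Lemma dvalN x : v (- x) = v x.
Proof.
have [->|x0] := eqVneq x 0; first by rewrite oppr0.
have n10 : (-1 : K) != 0 by rewrite oppr_eq0 oner_neq0.
suff vN1 : v (-1) = 0 by rewrite -mulN1r dvalM // vN1 add0r.
have := dvalM v n10 n10; rewrite mulrNN mulr1 dval1 => /eqP.
by rewrite eq_sym -mulr2n mulrn_eq0 => /eqP.
Qed.

Lemma val_geB n x y : val_ge v n x -> val_ge v n y -> val_ge v n (x - y).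
Proof.
rewrite /val_ge; have [->|x0] := eqVneq x 0.
  by rewrite sub0r oppr_eq0 dvalN.
have [->|y0] := eqVneq y 0; first by rewrite subr0 (negbTE x0).
rewrite /= => vx vy; case: eqVneq => //= xy0.
have ny0 : - y != 0 by rewrite oppr_eq0.
by apply: (le_trans _ (dvalD v x0 ny0 xy0)); rewrite le_min vx dvalN vy.
Qed.

Lemma val_geM m n x y :
  val_ge v m x -> val_ge v n y -> val_ge v (m + n) (x * y).
Proof.
rewrite /val_ge mulf_eq0; case: (eqVneq x 0) => //= x0 vx.
case: (eqVneq y 0) => //= y0 vy.
by rewrite dvalM // lerD.
Qed.

Definition val_ring : {pred K} := val_ge v 0.

Fact val_ring_subring_closed : subring_closed val_ring.
Proof.
split=> [|x y|x y]; rewrite /val_ring unfold_in.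
- by rewrite /val_ge dval1 lexx orbT.
- exact: val_geB.
- by move=> vx vy; rewrite -(addr0 0); apply: val_geM.
Qed.

HB.instance Definition _ :=
  GRing.isSubringClosed.Build K val_ring val_ring_subring_closed.

Record val_int := ValInt { val_int_val :> K; _ : val_int_val \in val_ring }.

HB.instance Definition _ := [isSub for val_int_val].
HB.instance Definition _ := [Choice of val_int by <:].
HB.instance Definition _ := [SubChoice_isSubComNzRing of val_int by <:].

Definition val_max_ideal : {pred val_int} :=
  fun x => val_ge v 1 (val_int_val x).

Fact val_max_ideal_closed : idealr_closed val_max_ideal.
Proof.
split; first by rewrite /val_max_ideal unfold_in /val_ge eqxx.
  by rewrite /val_max_ideal unfold_in /val_ge oner_eq0 dval1.
move=> a x y; rewrite /val_max_ideal !unfold_in /= => vx vy.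
have va : val_ge v 0 (val_int_val a) by exact: (valP a).
rewrite -[val_int_val y]opprK; apply: val_geB.
  by rewrite -(add0r 1); apply: val_geM.
by rewrite -sub0r; apply: val_geB; rewrite // /val_ge eqxx.
Qed.

HB.instance Definition _ :=
  isIdealr.Build val_int val_max_ideal val_max_ideal_closed.

Definition residue_field := {ideal_quot val_max_ideal}.

HB.instance Definition _ := GRing.ComNzRing.on residue_field.

Lemma residue_inv_ex (x : residue_field) :
  x != 0 -> exists y : residue_field, y * x == 1.
Proof.
elim/quotW: x => a a0.
have {a0} : a \notin val_max_ideal.
  apply: contraNN a0 => a_max.
  by rewrite -(rmorph0 (\pi_residue_field)%qT) -Quotient.idealrBE subr0.
rewrite unfold_in /val_max_ideal /val_ge negb_or -ltNge => /andP[a0 va_lt1].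
have va : v (val_int_val a) = 0.
  have := valP a; rewrite unfold_in /val_ge (negbTE a0) /= => va_ge0.
  by apply/eqP; rewrite eq_le va_ge0 andbT -ltzD1 add0r.
have inva_int : (val_int_val a)^-1 \in val_ring.
  have := dvalM v (invr_neq0 a0) a0.
  rewrite mulVf // dval1 va addr0 => vinv.
  by rewrite unfold_in /val_ge -vinv lexx orbT.
exists (\pi_residue_field (ValInt inva_int))%qT.
rewrite -rmorphM; apply/eqP; rewrite -(rmorph1 (\pi_residue_field)%qT).
by congr (\pi_residue_field _)%qT; apply: val_inj; rewrite /= mulVf.
Qed.

Definition residue_inv (x : residue_field) : residue_field :=
  if @idP (x != 0) is ReflectT x0 then xchoose (residue_inv_ex x0) else 0.

Fact residue_mulVf x : x != 0 -> residue_inv x * x = 1.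
Proof.
rewrite /residue_inv => x0; case: {-}_ / idP => // x0'.
by apply/eqP; apply: (xchooseP (residue_inv_ex x0')).
Qed.

Fact residue_inv0 : residue_inv 0 = 0.
Proof. by rewrite /residue_inv; case: {-}_ / idP => // x0; case: (negP x0 (eqxx _)). Qed.

HB.instance Definition _ :=
  GRing.ComNzRing_isField.Build residue_field residue_mulVf residue_inv0.

End ValuationRing.

Definition perfect (k : fieldType) : Prop :=
  forall q, q \in [pchar k] -> forall x : k, exists y : k, x = y ^+ q.

Definition val_complete (K : fieldType) (v : discrete_valuation K) : Prop :=
  forall u : nat -> K,
    (forall n : int, exists N : nat, forall i j : nat,
       (N <= i)%N -> (N <= j)%N -> val_ge v n (u i - u j)) ->
  exists l : K, forall n : int, exists N : nat, forall i : nat,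
    (N <= i)%N -> val_ge v n (u i - l).

Definition local_field (K : fieldType) (v : discrete_valuation K) : Prop :=
  val_complete v /\ perfect (residue_field v).

(* e(L/K) = e for the normalized valuations v of K and w of L; in particular w *)
(* extends v up to equivalence.                                               *)
Definition ramification_index (K : fieldType) (L : fieldExtType K)
    (v : discrete_valuation K) (w : discrete_valuation L) (e : nat) : Prop :=
  (0 < e)%N /\ forall x : K, x != 0 -> w x%:A = v x *+ e.

Definition totally_ramified (K : fieldType) (L : fieldExtType K)
    (v : discrete_valuation K) (w : discrete_valuation L) : Prop :=
  ramification_index v w (\dim {:L}).

Section Ramification.
Variables (p : nat) (K : fieldType) (L : splittingFieldType K).
Variables (w : discrete_valuation L) (pi : L).

(* Only meaningful for s != 1, as i(1) = +oo. *)
Definition ramif_i (s : gal_of {:L}) : int := w (s pi - pi) - 1.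

Definition ramif_group (x : int) : {set gal_of {:L}} :=
  [set s in 'Gal({:L} / 1)%g | (s == 1%g) || (x <= ramif_i s)].

Definition tame_degree : nat := ((\dim {:L})`_p^')%N.

(* bs is the sequence b_1 <= ... <= b_n of positive lower breaks, in which    *)
(* each b is repeated according to its multiplicity.                          *)
Definition lower_breaks (bs : seq nat) : Prop :=
  [/\ sorted leq bs, all (leq 1) bs &
      forall b : nat, (0 < b)%N ->
        #|ramif_group b%:Z : ramif_group b.+1%:Z|%g = (p ^ count_mem b bs)%N].

(* Indices are shifted: positive_upper_break bs i is u_(i+1), and bs`_i is    *)
(* b_(i+1).                                                                   *)
Fixpoint positive_upper_break (bs : seq nat) (i : nat) : rat :=
  if i is j.+1 then
    positive_upper_break bs j +
      ((nth 0%N bs j.+1)%:R - (nth 0%N bs j)%:R) / (tame_degree * p ^ j.+1)%:R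
  else (nth 0%N bs 0)%:R / tame_degree%:R.

End Ramification.

Definition upper_break (p : nat) (K : fieldType) (L : splittingFieldType K)
    (w : discrete_valuation L) (u : rat) : Prop :=
  (u = 0 /\ (1 < tame_degree p L)%N) \/
  exists (pi : L) (bs : seq nat) (i : nat),
    [/\ pi != 0 /\ w pi = 1, lower_breaks p w pi bs, (i < size bs)%N &
        u = positive_upper_break p L bs i].

(* Main.v *)
Require Import Defs.
From HB Require Import structures.
From Stdlib Require Import Classical_Prop.
From mathcomp Require Import all_boot all_order all_algebra.
From mathcomp Require Import all_fingroup all_solvable all_field.
From mathcomp Require Import zify ring.

Set Implicit Arguments.
Unset Strict Implicit.
Unset Printing Implicit Defensive.

Import Order.TTheory GRing.Theory Num.Theory.
Local Open Scope ring_scope.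

(* Realize p-groups over K by towers of Artin-Schreier steps y^p - y = b.  For
   a central step of order p, the additive Hilbert 90 theorem solves the
   embedding problem; the freedom of adding c^p t with t in K to b, together
   with completeness and perfectness of the residue field, makes the new lower
   break as large as desired, so that the earlier lower breaks persist.

   A nonabelian p-group G with p odd has a quotient H = H0 ><| <x1> whose
   derived subgroup C has order p and is central.  Realize H / (C <x1>) by a
   tower M of degree p^m.  Then e |-> [e, x1] gives a nontrivial character chi
   of Gal(M/K) with values in F_p, and there is x in M with e(x) = x + chi(e)
   and al := x^p - x in K; subtracting elements of K, one may assume
   w(x) = - n with n > 0 and p^m not dividing n.  With c in K of very negative
   valuation, X^p - X = c^p al defines the step for x1, with lower break b, and
   b' + c^p (al x + al^2 / 2) defines the step for C, where b' solves the
   embedding problem for H0.  Subtracting elements of the form u^p - u, its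
   lower break turns out to be b + p n, so the corresponding upper breaks differ
   by n / p^m, which is not an integer.  The rest of G is realized by further
   steps with larger breaks. *)

(** * Valuations *)

(** The two steps share the factor c^p because a second break that is merely large gives no hold on
    its distance to the first. The multiplier x is forced by the commutator: up to elements of M, e
    must translate the root for C by chi(e) X, where X^p - X = c^p al, and (chi(e) X)^p - chi(e) X =
    chi(e) c^p al is exactly the change of c^p al x under e. The term al^2 / 2 lies in K and leaves
    the action unchanged; it is there because al x + al^2 / 2 = (x^(2p) - x^2) / 2. Write x = z^p +
    rho. Modulo elements u^p - u and terms of larger valuation, c^p al becomes - c^p rho, and the
    second element becomes c^p (z^(2p) - x^2) / 2 = - c^p rho (z^p + x) / 2. With z chosen so that
    z^p + x has the valuation - n of x, the two valuations over M are - b and - (b + n). Passing to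
    M(X) turns b + n into p (b + n) - (p - 1) b = b + p n, and the upper numbering divides the jump
    p n by p^(m + 1). *)

Definition val_eq (K : fieldType) (w : discrete_valuation K) (n : int) (x : K) :=
  (x != 0) && (w x == n).

Section ValuationCalculus.
Variables (K : fieldType) (w : discrete_valuation K).
Implicit Types (x y : K) (m n : int).

Lemma val_ge0r n : val_ge w n 0. Proof. by rewrite /val_ge eqxx. Qed.
Hint Resolve val_ge0r : core.

Lemma val_geW m n x : m <= n -> val_ge w n x -> val_ge w m x.
Proof. by rewrite /val_ge => le_mn /orP[->|/(le_trans le_mn)->]; rewrite ?orbT. Qed.

Lemma val_geN n x : val_ge w n (- x) = val_ge w n x.
Proof. by rewrite /val_ge oppr_eq0 dvalN. Qed.

Lemma val_geD n x y : val_ge w n x -> val_ge w n y -> val_ge w n (x + y).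
Proof. by move=> wx wy; rewrite -[y]opprK val_geB ?val_geN. Qed.

Lemma val_ge_sum n (I : Type) (r : seq I) (P : pred I) (F : I -> K) :
  (forall i, P i -> val_ge w n (F i)) -> val_ge w n (\sum_(i <- r | P i) F i).
Proof. by move=> wF; elim/big_ind: _ => // x y; apply: val_geD. Qed.

Lemma val_ge1 : val_ge w 0 1. Proof. by rewrite /val_ge dval1 orbT. Qed.

Lemma val_geX n x k : val_ge w n x -> val_ge w (k%:Z * n) (x ^+ k).
Proof.
move=> wx; elim: k => [|k IHk]; first by rewrite mul0r expr0 val_ge1.
by rewrite exprS (_ : k.+1%:Z * n = n + k%:Z * n) ?val_geM //; lia.
Qed.

Lemma val_ge_eq n x : val_eq w n x -> val_ge w n x.
Proof. by case/andP=> _ /eqP; rewrite /val_ge => ->; rewrite lexx orbT. Qed.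

Lemma val_eq_andN n x : val_eq w n x = val_ge w n x && ~~ val_ge w (n + 1) x.
Proof.
rewrite /val_eq /val_ge; have [//|x0] := eqVneq x 0; rewrite /=; lia.
Qed.

Lemma val_eq_neq0 n x : val_eq w n x -> x != 0. Proof. by case/andP. Qed.

Lemma val_eqK n x : val_eq w n x -> w x = n. Proof. by case/andP=> _ /eqP. Qed.

Lemma val_eq_val x : x != 0 -> val_eq w (w x) x.
Proof. by rewrite /val_eq => ->; rewrite eqxx. Qed.

Lemma val_ge_val x : val_ge w (w x) x.
Proof. by rewrite /val_ge lexx orbT. Qed.

Lemma val_eqN n x : val_eq w n (- x) = val_eq w n x.
Proof. by rewrite !val_eq_andN !val_geN. Qed.

Lemma val_eqD n x y : val_eq w n x -> val_ge w (n + 1) y -> val_eq w n (x + y).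
Proof.
rewrite !val_eq_andN => /andP[wx nwx] wy; rewrite val_geD //=; last first.
  by apply: val_geW wy; lia.
by apply: contra nwx => wxy; rewrite -[x](addrK y) val_geB.
Qed.

Lemma val_eqDl n x y : val_ge w (n + 1) x -> val_eq w n y -> val_eq w n (x + y).
Proof. by move=> wx wy; rewrite addrC val_eqD. Qed.

Lemma val_eqM m n x y : val_eq w m x -> val_eq w n y -> val_eq w (m + n) (x * y).
Proof.
case/andP=> x0 /eqP wx /andP[y0 /eqP wy].
by rewrite /val_eq mulf_neq0 // dvalM // wx wy eqxx.
Qed.

Lemma val_eq1 : val_eq w 0 1. Proof. by rewrite /val_eq oner_neq0 dval1 eqxx. Qed.

Lemma val_eqX n x k : val_eq w n x -> val_eq w (k%:Z * n) (x ^+ k).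
Proof.
move=> wx; elim: k => [|k IHk]; first by rewrite mul0r expr0 val_eq1.
by rewrite exprS (_ : k.+1%:Z * n = n + k%:Z * n) ?val_eqM //; lia.
Qed.

Lemma val_eqV n x : val_eq w n x -> val_eq w (- n) x^-1.
Proof.
case/andP=> x0 /eqP wx; rewrite /val_eq invr_eq0 x0 /=.
by have := dvalM w x0 (invr_neq0 x0); rewrite divff // dval1 wx; lia.
Qed.

Lemma val_eqE_ge n m x : val_eq w n x -> val_ge w m x = (m <= n).
Proof. by case/andP=> /negbTE x0 /eqP wx; rewrite /val_ge x0 wx. Qed.

Lemma val_eq_inj m n x : val_eq w m x -> val_eq w n x -> m = n.
Proof. by move/val_eqK=> <- /val_eqK. Qed.

Lemma val_ge_trivial x : (forall n, val_ge w n x) -> x = 0.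
Proof.
move=> wx; apply/eqP; have [//|x0] := eqVneq x 0.
by have := wx (w x + 1); rewrite (val_eqE_ge _ (val_eq_val x0)); lia.
Qed.

Lemma uniformizer_exp n : exists x, val_eq w n x.
Proof.
have [t t0 wt] := dval_surj w; have vt : val_eq w 1 t by rewrite /val_eq t0 wt eqxx.
case: n => n; [exists (t ^+ n) | exists (t ^+ n.+1)^-1].
  by have := val_eqX n vt; rewrite mulr1.
by rewrite NegzE; apply: val_eqV; have := val_eqX n.+1 vt; rewrite mulr1.
Qed.

Lemma val_eq_root1 x k : (0 < k)%N -> x ^+ k = 1 -> val_eq w 0 x.
Proof.
move=> k0 xk; have x0 : x != 0.
  by apply: contraTneq (oner_neq0 K) => x0; rewrite -xk x0 expr0n gtn_eqF ?eqxx.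
have := val_eq_inj (val_eqX k (val_eq_val x0)); rewrite xk => /(_ _ val_eq1) /eqP.
by rewrite mulf_eq0 eqz_nat gtn_eqF //= /val_eq x0.
Qed.

Lemma val_eq_Frob p x : (1 < p)%N -> x != 0 -> x ^+ p = x -> val_eq w 0 x.
Proof.
move=> p1 x0 xp; apply: (@val_eq_root1 x p.-1); first by lia.
by apply: (mulfI x0); rewrite -exprS prednK ?mulr1 //; lia.
Qed.

Lemma val_ge_Frob p x : (1 < p)%N -> x ^+ p = x -> val_ge w 0 x.
Proof.
move=> p1 xp; have [->//|x0] := eqVneq x 0.
exact/val_ge_eq/(val_eq_Frob p1).
Qed.

End ValuationCalculus.
#[export] Hint Resolve val_ge0r : core.

(** Each nonzero element has a unique exact level, and additivity of exact levels under products
    makes this level a valuation. In an extension the filtration comes first: it is read off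
    coordinates. *)
Lemma filtration_valuation (L : fieldType) (ge : int -> pred L)
  (geq := fun n x => ge n x && ~~ ge (n + 1) x) :
  (forall n x y, ge n x -> ge n y -> ge n (x + y)) ->
  (forall m n x, m <= n -> ge n x -> ge m x) ->
  (forall n, ge n 0) ->
  (forall x, x != 0 -> exists n, geq n x) ->
  (forall m n x y, geq m x -> geq n y -> geq (m + n) (x * y)) ->
  (exists x, geq 1 x) ->
  exists w : discrete_valuation L, forall n x, val_ge w n x = ge n x.
Proof.
move=> geD geW ge0 ge_ex geqM [x1 gx1].
pose f x := if @idP (x != 0) is ReflectT x0 then xchoose (ge_ex x x0) else 0.
have fP x : x != 0 -> geq (f x) x.
  rewrite /f => x0; case: {-}_ / idP => // x0'; exact: (xchooseP (ge_ex x x0')).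
have geqE m n x : geq n x -> ge m x = (m <= n).
  case/andP=> gn ngn; apply/idP/idP => [gm|le_mn]; last exact: geW gn.
  by rewrite leNgt; apply: contra ngn => lt_nm; apply: geW gm; lia.
have geq_inj m n x : geq m x -> geq n x -> m = n.
  move=> gm gn; apply/eqP; rewrite eq_le -(geqE _ _ _ gn) -(geqE _ _ _ gm).
  by case/andP: gm => -> _; case/andP: gn => ->.
have geq0 n x : geq n x -> x != 0.
  by move=> gx; apply: contraTneq gx => ->; rewrite /geq !ge0.
have fM x y : x != 0 -> y != 0 -> f (x * y) = f x + f y.
  move=> x0 y0; apply: (@geq_inj _ _ (x * y)); first by rewrite fP ?mulf_neq0.
  by apply: geqM; apply: fP.
have fD x y : x != 0 -> y != 0 -> x + y != 0 -> Num.min (f x) (f y) <= f (x + y).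
  move=> x0 y0 xy0; rewrite -(geqE _ _ _ (fP _ xy0)).
  by apply: geD; rewrite (geqE _ _ _ (fP _ _)) // ge_min lexx ?orbT.
have f1 : exists2 x, x != 0 & f x = 1.
  by exists x1; [apply: geq0 gx1 | apply: (geq_inj _ _ x1) => //; apply: fP; apply: geq0 gx1].
exists (DiscreteValuation fM fD f1) => n x; rewrite /val_ge /=.
by have [->|x0] := eqVneq x 0; rewrite ?ge0 //= (geqE _ _ _ (fP _ x0)).
Qed.

(** * Artin-Schreier extensions *)

Section ArtinSchreierPolynomial.
Variables (F : fieldType) (w : discrete_valuation F) (p B : nat) (beta : F).
Hypothesis pr_p : prime p.

Definition AS_poly : {poly F} := 'X^p - 'X - beta%:P.
Local Notation f := AS_poly.

(* The weight of X is -B/p, the valuation of a root of X^p - X - beta;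
   everything is multiplied by p to stay in the integers. *)
Definition coef_weight (j : nat) (c : F) : int := p%:Z * w c - B%:Z * j%:Z.

Definition coef_ge (n : int) (j : nat) (c : F) :=
  (c == 0) || (n <= coef_weight j c).

Definition poly_ge (n : int) (h : {poly F}) := forall j, coef_ge n j h`_j.

Lemma coef_geD n j c d : coef_ge n j c -> coef_ge n j d -> coef_ge n j (c + d).
Proof.
rewrite /coef_ge /coef_weight; have [->|c0] := eqVneq c 0; first by rewrite add0r.
have [->|d0] := eqVneq d 0; first by rewrite addr0 (negbTE c0).
case: eqVneq => //= cd0; have p0 := prime_gt0 pr_p; have := dvalD w c0 d0 cd0.
by rewrite ge_min => /orP[] ?; nia.
Qed.

Lemma coef_geM m n i j c d :
  coef_ge m i c -> coef_ge n j d -> coef_ge (m + n) (i + j) (c * d).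
Proof.
rewrite /coef_ge /coef_weight mulf_eq0; case: eqVneq => //= c0.
case: eqVneq => //= d0; rewrite dvalM //; lia.
Qed.

Lemma coef_geW m n j c : m <= n -> coef_ge n j c -> coef_ge m j c.
Proof. by rewrite /coef_ge => le_mn /orP[->//|/(le_trans le_mn)->]; rewrite orbT. Qed.

Lemma poly_geW m n h : m <= n -> poly_ge n h -> poly_ge m h.
Proof. by move=> le_mn wh j; apply: coef_geW (wh j). Qed.

Lemma poly_geD n g h : poly_ge n g -> poly_ge n h -> poly_ge n (g + h).
Proof. by move=> wg wh j; rewrite coefD coef_geD. Qed.

Lemma poly_ge0 n : poly_ge n 0.
Proof. by move=> j; rewrite coef0 /coef_ge eqxx. Qed.

Lemma poly_geM m n g h : poly_ge m g -> poly_ge n h -> poly_ge (m + n) (g * h).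
Proof.
move=> wg wh j; rewrite coefM; elim/big_ind: _ => [|c d|i _].
- by rewrite /coef_ge eqxx.
- exact: coef_geD.
by have := coef_geM (wg i) (wh (j - i)%N); rewrite subnKC // -ltnS.
Qed.

Lemma poly_ge_monom n c i : coef_ge n i c -> poly_ge n (c *: 'X^i).
Proof.
move=> wc j; rewrite coefZ coefXn; case: eqVneq => [->|_]; first by rewrite mulr1.
by rewrite mulr0 /coef_ge eqxx.
Qed.

Lemma size_AS_poly : size f = p.+1.
Proof.
rewrite /f -addrA size_polyDl size_polyXn // -opprD size_polyN.
apply: leq_ltn_trans (size_polyD _ _) _; rewrite size_polyX size_polyC.
by have := prime_gt1 pr_p; case: eqP => /=; lia.
Qed.

Lemma AS_poly_neq0 : f != 0.
Proof. by rewrite -size_poly_eq0 size_AS_poly. Qed.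

Lemma size_modAS (h : {poly F}) : (size (h %% f)%R <= p)%N.
Proof. by rewrite -ltnS -size_AS_poly ltn_modp AS_poly_neq0. Qed.

Lemma modAS_small (h : {poly F}) : (size h <= p)%N -> h %% f = h.
Proof. by move=> sh; rewrite modp_small // size_AS_poly. Qed.

Lemma modAS_monom c k :
  (c *: 'X^(p + k)) %% f = (c *: 'X^(k.+1) + (c * beta) *: 'X^k) %% f.
Proof.
have -> : c *: 'X^(p + k) = (c *: 'X^k) * f + (c *: 'X^(k.+1) + (c * beta) *: 'X^k) :> {poly F}.
  by rewrite /f exprD exprS -!mul_polyC !polyCM; ring.
by rewrite modpD modp_mull add0r.
Qed.

Hypotheses (B_gt0 : (0 < B)%N) (pB : ~~ (p %| B)%N).
Hypothesis w_beta : val_eq w (- B%:Z) beta.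

(** The reduction X^p = X + beta: [beta] has exactly the weight - p B of X^p, while X has weight -
    B, a gain of (p - 1) B. *)
Lemma coef_ge_reduce n c k : coef_ge n (p + k) c ->
  coef_ge n k (c * beta) /\ coef_ge (n + (p.-1 * B)%:Z) k.+1 c.
Proof.
have [b0 wb] := andP w_beta; have p1 := prime_gt1 pr_p.
rewrite /coef_ge /coef_weight mulf_eq0 (negbTE b0) orbF.
have [//|c0] := eqVneq c 0; rewrite /= dvalM // (eqP wb).
rewrite (_ : (p.-1 * B)%:Z = p%:Z * B%:Z - B%:Z); first by lia.
by case: (p) p1 => //= q _; lia.
Qed.

Lemma poly_ge_modAS n h : poly_ge n h -> poly_ge n (h %% f).
Proof.
have [m] := ubnP (size h); elim: m => // m IHm in h *.
rewrite ltnS => sh wh; have [hp|hp] := leqP (size h) p; first by rewrite modAS_small.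
set k := ((size h).-1 - p)%N; have Dk : (size h).-1 = (p + k)%N by rewrite /k; lia.
pose c := lead_coef h; pose h0 := h - c *: 'X^(p + k).
have Dc : c = h`_(p + k) by rewrite -Dk.
have [wc1 wc2] : coef_ge n k (c * beta) /\ coef_ge (n + (p.-1 * B)%:Z) k.+1 c.
  by apply: coef_ge_reduce; rewrite Dc.
pose h1 := h0 + (c *: 'X^(k.+1) + (c * beta) *: 'X^k).
have -> : h %% f = h1 %% f.
  by rewrite /h1 modpD -modAS_monom -modpD subrK.
have p1 := prime_gt1 pr_p.
have szle : forall i, ((size h).-1 <= i)%N -> h1`_i = 0.
  move=> i hi; rewrite /h1 /h0 !coefD coefN !coefZ !coefXn.
  rewrite (_ : (i == k.+1) = false) 1?(_ : (i == k) = false) ?mulr0 ?addr0; try lia.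
  case: eqVneq => [->|neq]; first by rewrite mulr1 Dc subrr.
  have szh : (size h <= i)%N by lia.
  by rewrite mulr0 subr0 nth_default ?addr0.
apply: IHm.
  have : (size h1 <= (size h).-1)%N by apply/leq_sizeP.
  by lia.
apply: poly_geD; last first.
  by apply: poly_geD; apply: poly_ge_monom => //; apply: coef_geW wc2; rewrite lerDl.
move=> j; rewrite /h0 coefB coefZ coefXn; case: eqVneq => [->|_].
  by rewrite mulr1 Dc subrr /coef_ge eqxx.
by rewrite mulr0 subr0.
Qed.

(** The weight of c X^j is congruent to - B j modulo p, and B is invertible modulo p. *)
Lemma coef_weight_inj i j c d : (i < p)%N -> (j < p)%N ->
  coef_weight i c = coef_weight j d -> i = j.
Proof.
rewrite /coef_weight => ip jp E.
have : (p%:Z %| (B%:Z * (i%:Z - j%:Z)))%Z.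
  by apply/dvdzP; exists (w c - w d); lia.
rewrite Gauss_dvdzr; last by rewrite coprimezE /= prime_coprime.
move=> /dvdzP[q Dq]; have [q_lt|q_gt|q0] := ltrgtP q 0; last by lia.
  by have : q * p%:Z <= - p%:Z; [nia | lia].
by have : p%:Z <= q * p%:Z; [nia | lia].
Qed.

(** Monomials of different degrees below p have different weights, so the minimum is attained once
    and all other terms lie at least one level deeper. *)
Lemma poly_weight_ex (h : {poly F}) : h != 0 -> (size h <= p)%N ->
  exists n i, [/\ (i < p)%N, h`_i != 0, coef_weight i h`_i = n,
                  poly_ge n h & poly_ge (n + 1) (h - h`_i *: 'X^i)].
Proof.
move=> h0 sh; have sh0 : (0 < size h)%N by rewrite size_poly_gt0.
have hS : ((size h).-1 < size h)%N by rewrite prednK.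
have iP : h`_(Ordinal hS) != 0.
  by rewrite /= -/(lead_coef h) lead_coef_eq0.
case: (@arg_minP _ _ _ _ (fun j : 'I_(size h) => h`_j != 0)
          (fun j : 'I_(size h) => coef_weight j h`_j) iP) => i hi0 min_i.
have ip : (i < p)%N by apply: leq_trans sh.
have wh : poly_ge (coef_weight i h`_i) h.
  move=> j; rewrite /coef_ge; case: eqVneq => //= hj0.
  have jh : (j < size h)%N by rewrite ltnNge; apply: contra hj0 => /(nth_default 0)->.
  exact: (min_i (Ordinal jh)).
exists (coef_weight i h`_i), i; split=> // j.
rewrite coefB coefZ coefXn; case: eqVneq => [->|ne_ji].
  by rewrite mulr1 subrr /coef_ge eqxx.
rewrite mulr0 subr0; have:= wh j; rewrite /coef_ge; case: eqVneq => //= hj0.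
rewrite le_eqVlt => /orP[/eqP E|]; last by rewrite lezD1.
have jh : (j < size h)%N by rewrite ltnNge; apply: contra hj0 => /(nth_default 0)->.
by move: ne_ji; rewrite (coef_weight_inj ip (leq_trans jh sh) E) eqxx.
Qed.

Lemma coef_weight_add n j c d : c != 0 -> coef_weight j c = n ->
  coef_ge (n + 1) j d -> c + d != 0 /\ coef_weight j (c + d) = n.
Proof.
move=> c0 wc wd; have p0 := prime_gt0 pr_p.
have wcd : val_ge w (w c + 1) d.
  move: wd wc; rewrite /coef_ge /val_ge /coef_weight; case: eqVneq => //= d0; nia.
have /andP[cd0 /eqP wcd'] := val_eqD (val_eq_val w c0) wcd.
by rewrite /coef_weight wcd'.
Qed.

Definition poly_eq n (h : {poly F}) := poly_ge n h /\ ~ poly_ge (n + 1) h.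

Lemma poly_eqP n i (h : {poly F}) : h`_i != 0 -> coef_weight i h`_i = n ->
  poly_ge n h -> poly_eq n h.
Proof. by move=> h0 hn; split=> // /(_ i); rewrite /coef_ge (negbTE h0) hn /=; lia. Qed.

Lemma poly_eq_ex (h : {poly F}) : h != 0 -> (size h <= p)%N -> exists n, poly_eq n h.
Proof.
by move=> h0 /(poly_weight_ex h0)[n [i [_ hi0 wi wh _]]]; exists n; exact: (poly_eqP hi0 wi wh).
Qed.

Lemma poly_eq_neq0 n h : poly_eq n h -> h != 0.
Proof. by case=> _ nh; apply/eqP=> h0; case: nh; rewrite h0; apply: poly_ge0. Qed.

Lemma poly_eq_inj m n h : poly_eq m h -> poly_eq n h -> m = n.
Proof.
move=> [hm nm] [hn nn]; have [lt|lt|//] := ltgtP m n.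
  by case: nm; apply: poly_geW hn; lia.
by case: nn; apply: poly_geW hm; lia.
Qed.

(** The product of the two dominant monomials dominates. If its degree is p + k, reduction puts c d
    beta, of the same weight, in degree k, where the deeper terms cannot cancel it. *)
Lemma poly_eqM m n (g h : {poly F}) : (size g <= p)%N -> (size h <= p)%N ->
  poly_eq m g -> poly_eq n h -> poly_eq (m + n) ((g * h) %% f).
Proof.
move=> sg sh wg wh.
have [m' [i [ip gi0 wi wgm Rg]]] := poly_weight_ex (poly_eq_neq0 wg) sg.
have Em : m' = m by apply: poly_eq_inj wg; exact: (poly_eqP gi0 wi wgm).
have [n' [j [jp hj0 wj whn Rh]]] := poly_weight_ex (poly_eq_neq0 wh) sh.
have En : n' = n by apply: poly_eq_inj wh; exact: (poly_eqP hj0 wj whn).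
rewrite {}Em in wi wgm Rg; rewrite {}En in wj whn Rh.
set c := g`_i in gi0 wi Rg *; set d := h`_j in hj0 wj Rh *.
set g1 := g - _ in Rg; set h1 := h - _ in Rh.
have cd0 : c * d != 0 by rewrite mulf_neq0.
have wcd : coef_weight (i + j) (c * d) = m + n.
  by rewrite -wi -wj /coef_weight dvalM //; lia.
have wgh : poly_ge (m + n) ((g * h) %% f).
  by apply/poly_ge_modAS/poly_geM.
pose R := (c *: 'X^i) * h1 + g1 * h.
have wR : poly_ge (m + n + 1) (R %% f).
  apply: poly_ge_modAS; apply: poly_geD.
    rewrite -addrA; apply: poly_geM => //; apply: poly_ge_monom.
    by rewrite /coef_ge wi lexx orbT.
  by rewrite -addrA (addrC n) addrA; apply: poly_geM.
have Dgh : (g * h) %% f = ((c * d) *: 'X^(i + j)) %% f + R %% f.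
  by rewrite -modpD; congr (_ %% _); rewrite /R /h1 /g1 exprD -!mul_polyC polyCM; ring.
have finish k e : e != 0 -> coef_weight k e = m + n ->
  (((c * d) *: 'X^(i + j)) %% f)`_k = e -> poly_eq (m + n) ((g * h) %% f).
- move=> e0 we De; have [] := coef_weight_add e0 we (wR k).
  by rewrite -De -coefD -Dgh => gh0 wgh0; exact: (poly_eqP gh0 wgh0 wgh).
have p1 := prime_gt1 pr_p.
have [ijp|ijp] := ltnP (i + j) p.
  apply: (finish (i + j)%N (c * d)) => //.
  rewrite modAS_small ?coefZ ?coefXn ?eqxx ?mulr1 //.
  by apply: leq_trans (size_scale_leq _ _) _; rewrite size_polyXn.
set k := (i + j - p)%N; have Dij : (i + j = p + k)%N by rewrite /k; lia.
have [b0 wb] := andP w_beta.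
apply: (finish k (c * d * beta)); first by rewrite mulf_neq0.
  by rewrite -wcd Dij /coef_weight dvalM // (eqP wb); lia.
rewrite Dij modAS_monom modAS_small.
  by rewrite coefD !coefZ !coefXn eqxx mulr1 (_ : (k == k.+1) = false) ?mulr0 ?add0r //; lia.
apply: leq_trans (size_polyD _ _) _; rewrite geq_max.
by rewrite !(leq_trans (size_scale_leq _ _)) // size_polyXn /k; lia.
Qed.

(** If both factors had degree below p, each would have a finite weight, and the sum would be the
    weight of their product modulo f, which is 0. *)
Lemma AS_poly_irreducible : irreducible_poly f.
Proof.
have p1 := prime_gt1 pr_p.
split=> [|q q1 /dvdpP[g Dgq]]; first by rewrite size_AS_poly; lia.
have fgq0 : g * q != 0 by rewrite -Dgq AS_poly_neq0.
have /andP[g0 q0] : (g != 0) && (q != 0) by rewrite -negb_or -mulf_eq0.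
have := size_AS_poly; rewrite Dgq size_mul // => szgq.
have q_gt0 : (0 < size q)%N by rewrite size_poly_gt0.
have g_gt0 : (0 < size g)%N by rewrite size_poly_gt0.
have [sq|sq] := ltnP p (size q).
  have sq' : size q = p.+1.
    by move: szgq sq q_gt0 g_gt0; move: (size q) (size g) => a b; lia.
  by rewrite -dvdp_size_eqp -?Dgq ?size_AS_poly ?sq' // Dgq dvdp_mull.
have sg : (size g <= p)%N.
  by move: szgq q1 q_gt0 g_gt0; move: (size q) (size g) => a b; lia.
have [m wg] := poly_eq_ex g0 sg; have [n wq] := poly_eq_ex q0 sq.
by have /poly_eq_neq0 := poly_eqM sg sq wg wq; rewrite -Dgq modpp eqxx.
Qed.

End ArtinSchreierPolynomial.

Section ArtinSchreierExtension.
Variables (F : fieldType) (w : discrete_valuation F) (p B : nat) (beta : F).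
Hypotheses (pr_p : prime p) (B_gt0 : (0 < B)%N) (pB : ~~ (p %| B)%N).
Hypothesis w_beta : val_eq w (- B%:Z) beta.
Local Notation f := (AS_poly p beta).

Lemma AS_adjoin :
  exists (L : fieldExtType F) (y : L) (ev := fun h => (map_poly (in_alg L) h).[y]),
  [/\ \dim {:L} = p,
      forall x : L, exists2 h : {poly F}, (size h <= p)%N & ev h = x &
      forall h, (ev h == 0) = (f %| h)].
Proof.
have irr_f := AS_poly_irreducible pr_p B_gt0 pB w_beta.
have [L dimL [y fy gen_y]] := irredp_FAdjoin irr_f.
exists L, y; set ev := fun h => _.
have evD g h : ev (g + h) = ev g + ev h by rewrite /ev rmorphD hornerD.
have evM g h : ev (g * h) = ev g * ev h by rewrite /ev rmorphM hornerM.
have evf : ev f = 0 by apply/eqP.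
have ev_mod h : ev (h %% f) = ev h.
  by rewrite [in RHS](divp_eq h f) evD evM evf mulr0 add0r.
split=> [|x|h]; first by rewrite dimL size_AS_poly.
  have /Fadjoin_polyP[q /polyOver1P[h ->] ->] : x \in <<1; y>>%VS.
    by rewrite gen_y memvf.
  by exists (h %% f); [apply: size_modAS | rewrite ev_mod].
apply/eqP/idP => [evh|/dvdpP[g ->]]; last by rewrite evM evf mulr0.
apply: contraT => nfh; have : coprimep f h.
  rewrite /coprimep; apply: contraR nfh => /(irr_f.2) /(_ (dvdp_gcdl _ _)) Df.
  by rewrite -(eqp_dvdl _ Df) dvdp_gcdr.
case/Bezout_eq1_coprimepP => -[u v] /= /(congr1 ev).
by rewrite evD !evM evf evh !mulr0 addr0 /ev rmorph1 hornerC => /eqP; rewrite eq_sym oner_eq0.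
Qed.

Lemma AS_valuation (L : fieldType) (iota : {rmorphism F -> L}) (y : L)
    (ev := fun h => (map_poly iota h).[y]) :
  (forall x : L, exists2 h : {poly F}, (size h <= p)%N & ev h = x) ->
  (forall h, (ev h == 0) = (f %| h)) ->
  exists wL : discrete_valuation L,
    forall n (h : {poly F}), (size h <= p)%N -> val_ge wL n (ev h) <-> poly_ge w p B n h.
Proof.
move=> ev_surj ev_eq0; have p1 := prime_gt1 pr_p.
have evD g h : ev (g + h) = ev g + ev h by rewrite /ev rmorphD hornerD.
have evB g h : ev (g - h) = ev g - ev h by rewrite /ev rmorphB hornerD hornerN.
have evM g h : ev (g * h) = ev g * ev h by rewrite /ev rmorphM hornerM.
have evf : ev f = 0 by apply/eqP; rewrite ev_eq0.
have ev_mod h : ev (h %% f) = ev h.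
  by rewrite [in RHS](divp_eq h f) evD evM evf mulr0 add0r.
have ev_inj (g h : {poly F}) : (size g <= p)%N -> (size h <= p)%N -> ev g = ev h -> g = h.
  move=> sg sh /eqP; rewrite -subr_eq0 -evB ev_eq0 /dvdp modAS_small // ?subr_eq0 => [/eqP//|].
  by apply: leq_trans (size_polyD _ _) _; rewrite size_polyN geq_max sg.
have coordP x : exists h : {poly F}, (size h <= p)%N && (ev h == x).
  by have [h sh /eqP Eh] := ev_surj x; exists h; rewrite sh.
pose coord x := xchoose (coordP x).
have coord_size x : (size (coord x) <= p)%N by case/andP: (xchooseP (coordP x)).
have coordK x : ev (coord x) = x by case/andP: (xchooseP (coordP x)) => _ /eqP.
have evK (h : {poly F}) : (size h <= p)%N -> coord (ev h) = h by move=> sh; apply: ev_inj.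
have coord_ev h : coord (ev h) = h %% f.
  by rewrite -ev_mod evK ?size_modAS.
pose ge n x := [forall j : 'I_p, coef_ge w p B n j (coord x)`_j].
have geP n x : reflect (poly_ge w p B n (coord x)) (ge n x).
  apply: (iffP forallP) => [wx j|//]; have [jp|jp] := ltnP j p; first exact: (wx (Ordinal jp)).
  by rewrite nth_default ?(leq_trans (coord_size x)) // /coef_ge eqxx.
have geqP n x : reflect (poly_eq w p B n (coord x)) (ge n x && ~~ ge (n + 1) x).
  apply: (iffP andP) => [[/geP ? /geP ?]|[? ?]]; split=> //; exact/geP.
have [|||x x0|m n x y0 /geqP wx /geqP wy||wL wLP] := @filtration_valuation L ge.
- move=> n x x' /geP wx /geP wx'; apply/geP.
  rewrite -[x]coordK -[x']coordK -evD coord_ev modpD !modAS_small //.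
  exact: poly_geD.
- by move=> m n x le_mn /geP wx; apply/geP; apply: poly_geW wx.
- move=> n; apply/geP; rewrite (_ : 0 = ev 0) ?evK ?size_poly0 //; first exact: poly_ge0.
  by rewrite /ev rmorph0 horner0.
- have cx0 : coord x != 0.
    by apply: contraNneq x0 => cx; rewrite -[x]coordK cx /ev rmorph0 horner0.
  by have [n wn] := poly_eq_ex pr_p B_gt0 pB w_beta cx0 (coord_size x); exists n; apply/geqP.
- apply/geqP; rewrite -[x]coordK -[y0]coordK -evM coord_ev.
  by apply: poly_eqM.
- have : coprime B p by rewrite coprime_sym prime_coprime.
  rewrite coprime_sym => /coprimeP-/(_ (prime_gt0 pr_p))[[u v] /= Euv].
  (* A monomial of weight 1: p divides 1 + B j, and the coefficient gets valuation (1 + B j) / p. *)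
  pose j := (v %% p)%N; have jp : (j < p)%N by rewrite ltn_mod prime_gt0.
  have /dvdzP[q Dq] : (p%:Z %| 1 + B%:Z * j%:Z)%Z.
    apply/dvdzP; exists (u%:Z - B%:Z * (v %/ p)%N%:Z).
    by have := divn_eq v p; rewrite -/j; nia.
  have [c wc] := uniformizer_exp w q; have [c0 /eqP wc'] := andP wc.
  have wj : coef_weight w p B j c = 1 by rewrite /coef_weight wc'; lia.
  exists (ev (c *: 'X^j)); apply/geqP; rewrite evK; last first.
    by apply: leq_trans (size_scale_leq _ _) _; rewrite size_polyXn.
  apply: (poly_eqP pr_p B_gt0 pB w_beta (i := j)); rewrite ?coefZ ?coefXn ?eqxx ?mulr1 //.
  by apply: poly_ge_monom; rewrite /coef_ge wj lexx orbT.
exists wL => n h sh; rewrite wLP; split=> [/geP|wh]; first by rewrite evK.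
by apply/geP; rewrite evK.
Qed.

End ArtinSchreierExtension.

Lemma AS_tower_extension (K : fieldType) (M : fieldExtType K)
    (w : discrete_valuation M) (p B : nat) (beta : M) :
  prime p -> (0 < B)%N -> ~~ (p %| B)%N -> val_eq w (- B%:Z) beta ->
  exists (L : fieldExtType K) (iota : {rmorphism M -> L}) (y : L)
    (wL : discrete_valuation L) (ev := fun h => (map_poly iota h).[y]),
  [/\ forall k : K, iota k%:A = k%:A, (\dim {:L} = p * \dim {:M})%N,
      forall x : L, exists2 h : {poly M}, (size h <= p)%N & ev h = x,
      forall h, (ev h == 0) = (AS_poly p beta %| h) &
      forall n (h : {poly M}), (size h <= p)%N -> val_ge wL n (ev h) <-> poly_ge w p B n h].
Proof.
move=> pr_p B_gt0 pB w_beta.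
have [L0 [y [dimL ev_surj ev_eq0]]] := AS_adjoin pr_p B_gt0 pB w_beta.
have [wL wLP] := AS_valuation pr_p B_gt0 pB w_beta ev_surj ev_eq0.
exists (baseFieldType L0), (in_alg L0), y, wL; split=> //.
rewrite -dimL -dim_baseVspace; congr (\dim _).
apply/vspaceP=> x; have xB : x \in baseVspace {:L0}.
  by rewrite mem_baseVspace; apply: (@memvf _ L0 x).
by apply: etrans (memvf x) _; apply: esym xB.
Qed.

(** * Galois groups from actions *)

Lemma galT (K : fieldType) (L : splittingFieldType K) :
  'Gal({:L} / 1)%g = [set: gal_of {:L}].
Proof.
apply/setP=> g; rewrite inE gal_kHom ?sub1v // k1HomE.
exact: (valP (g : 'AEnd(L))).
Qed.

Section GaloisFromAction.
Variables (K : fieldType) (gT : finGroupType) (E : {group gT}).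

(** The composition order is that of [galM]: e acts before e'. The action may have a kernel, so that
    E can act through a quotient. *)
Definition field_action (L : fieldExtType K) (s : gT -> L -> L) :=
  [/\ {in E, forall e, exists2 r : {rmorphism L -> L}, r =1 s e & scalable r},
      {in E &, forall e e' x, s (e * e')%g x = s e' (s e x)} &
      forall x, {in E, forall e, s e x = x} -> x \in 1%VS].

(** The orbit polynomial of x, with one linear factor for each element of E, has coefficients in K;
    the minimal polynomial of x divides it and so splits. *)
Lemma field_action_splitting (L : fieldExtType K) (s : gT -> L -> L) :
  field_action s -> SplittingField.axiom L.
Proof.
move=> [s_morph sM s_fix]; apply: normal_field_splitting => K' x.
pose q := \prod_(e in E) ('X - (s e x)%:P).
have q1 : q \is a polyOver 1%VS.
  apply/polyOverP=> i; apply: s_fix => e Ee.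
  have [r rs _] := s_morph e Ee; rewrite -rs -coef_map; congr (_ : {poly _})`_i.
  rewrite /q rmorph_prod [RHS](reindex_inj (mulIg e)) /=.
  apply: eq_big => [e'|e' Ee']; first by rewrite groupMr.
  by rewrite rmorphB /= map_polyX map_polyC /= rs sM.
have s1 : s 1%g x = x.
  have [r rs _] := s_morph 1%g (group1 E).
  by apply: (fmorph_inj r); rewrite !rs -sM ?group1 ?mulg1.
have qx : root q x.
  by rewrite /q (bigD1 1%g) //= s1 rootM root_XsubC eqxx.
have : minPoly K' x %| q.
  apply: minPoly_dvdp => //; apply/polyOverP=> i.
  exact: (subvP (sub1v K')) (polyOverP q1 i).
rewrite /q -big_enum /= -(big_map (fun e => s e x) xpredT (fun y => 'X - y%:P)).
case/dvdp_prod_XsubC=> m; set rs := mask _ _ => Dm; exists rs.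
by rewrite -eqp_monic ?monic_minPoly ?monic_prod_XsubC.
Qed.

(** Surjectivity is Artin's theorem: the image of E has fixed field K, so it is the whole Galois
    group. *)
Lemma field_action_gal (L : splittingFieldType K) (s : gT -> L -> L) :
  field_action s -> exists phi : gT -> gal_of {:L},
  [/\ galois 1 {:L}, {in E, forall e, phi e =1 s e},
      {in E &, {morph phi : e e' / e * e'}%g} & forall g, exists2 e, e \in E & phi e = g].
Proof.
move=> [s_morph sM s_fix].
have phi_ex e : exists g : gal_of {:L}, e \in E -> g =1 s e.
  have [Ee|nEe] := boolP (e \in E); last by exists 1%g.
  have [r rs r_lin] := s_morph e Ee.
  have rL : linear r by move=> k x y; rewrite rmorphD r_lin.
  pose rl : {linear L -> L} := HB.pack (r : L -> L) (GRing.isLinear.Build _ _ _ _ _ rL).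
  have kr : kAut 1 {:L} (linfun rl).
    rewrite kAutfE k1HomE; apply/ahom_inP.
    by split=> [x y|]; rewrite !lfunE /= ?rmorphM ?rmorph1.
  have [g _ gr] := kAut_to_gal kr; exists g => _ x.
  by rewrite -gr ?memvf // lfunE /= rs.
have [phi phiE] := fin_all_exists phi_ex.
have phiM : {in E &, {morph phi : e e' / e * e'}%g}.
  move=> e e' Ee Ee'; apply/eqP/gal_eqP=> x _.
  by rewrite galM ?memvf // !phiE ?groupM // sM.
have imG : group_set [set phi e | e in E].
  apply/group_setP; split=> [|_ _ /imsetP[e Ee ->] /imsetP[e' Ee' ->]].
    apply/imsetP; exists 1%g => //; apply: (mulgI (phi 1%g)).
    by rewrite -phiM ?mulg1.
  by rewrite -phiM // imset_f ?groupM.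
pose G := Group imG; have fixG : fixedField G = 1%AS.
  apply/vspaceP=> x; apply/idP/idP=> [/mem_fixedFieldP[_ fx]|x1].
    by apply: s_fix => e Ee; rewrite -phiE // fx ?imset_f.
  apply/fixedFieldP=> [|g _]; first exact: memvf.
  by have/vlineP[k ->] := x1; rewrite rmorph_alg.
have galG := gal_fixedField G; rewrite fixG in galG.
exists phi; split=> [|e Ee x||g] //; last first.
- have : g \in G by rewrite -galG galT inE.
  by case/imsetP=> e Ee ->; exists e.
- exact: phiE.
by have := fixedField_galois G; rewrite fixG.
Qed.

End GaloisFromAction.

(** * Valuations in characteristic p *)

Section FrobeniusLemmas.
Variables (F : fieldType) (p : nat).
Hypothesis charF : p \in [pchar F].
Implicit Types x y : F.

Lemma FrobD x y : (x + y) ^+ p = x ^+ p + y ^+ p.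
Proof. exact: (pFrobenius_autD_comm charF (mulrC _ _)). Qed.

Lemma FrobN x : (- x) ^+ p = - x ^+ p.
Proof. exact: (pFrobenius_autN charF). Qed.

Lemma FrobB x y : (x - y) ^+ p = x ^+ p - y ^+ p.
Proof. by rewrite FrobD FrobN. Qed.

Lemma Frob_nat n : (n%:R : F) ^+ p = n%:R.
Proof. exact: (pFrobenius_aut_nat charF). Qed.

Lemma natr_neq0 n : ~~ (p %| n)%N -> (n%:R : F) != 0.
Proof. by rewrite (dvdn_pcharf charF). Qed.

Lemma val_eq_nat (w : discrete_valuation F) n : ~~ (p %| n)%N -> val_eq w 0 n%:R.
Proof.
move=> pn; have /andP[pr_p _] := charF.
by rewrite (val_eq_Frob _ (prime_gt1 pr_p)) ?natr_neq0 ?Frob_nat.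
Qed.

Lemma val_ge_nat (w : discrete_valuation F) n : val_ge w 0 n%:R.
Proof.
by have /andP[pr_p _] := charF; apply: (val_ge_Frob _ (prime_gt1 pr_p)); rewrite Frob_nat.
Qed.

Lemma val_exp1D (w : discrete_valuation F) i u j : 0 < i -> val_ge w i u ->
  exists2 R, (1 + u) ^+ j - 1 = j%:R * u + R & val_ge w (i + 1) R.
Proof.
move=> i_gt0 wu; elim: j => [|j [R DR wR]].
  by exists 0; rewrite ?expr0 ?subrr ?mul0r ?addr0.
exists (j%:R * u * u + (1 + u) * R).
  rewrite exprS (_ : _ - 1 = (1 + u) * ((1 + u) ^+ j - 1) + u); last by ring.
  by rewrite DR -natr1; ring.
apply: val_geD.
  apply: (@val_geW _ _ _ (0 + i + i)); first by lia.
  by rewrite !val_geM ?val_ge_nat.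
rewrite -[i + 1]add0r val_geM // val_geD ?val_ge1 //.
by apply: val_geW wu; lia.
Qed.

Lemma val_powD_ge (w : discrete_valuation F) n i y A j : 0 < i ->
  val_eq w n y -> val_ge w (n + i) A -> val_ge w (n * j%:Z + i) ((y + A) ^+ j - y ^+ j).
Proof.
move=> i_gt0 wy wA; have y0 := val_eq_neq0 wy.
have wu : val_ge w i (A / y).
  by have := val_geM wA (val_ge_eq (val_eqV wy)); rewrite addrAC subrr add0r.
have [R DR wR] := val_exp1D j i_gt0 wu.
have -> : (y + A) ^+ j - y ^+ j = y ^+ j * ((1 + A / y) ^+ j - 1).
  by rewrite mulrBr mulr1 -exprMn mulrDr mulr1 mulrCA divff ?mulr1.
rewrite DR val_geM //; first by rewrite mulrC val_ge_eq ?val_eqX.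
apply: val_geD; first by rewrite -[i]add0r val_geM ?val_ge_nat.
by apply: val_geW wR; lia.
Qed.

(** With u = A / y, the difference (1 + u)^j - 1 is j u up to deeper terms, and j is a unit because
    p does not divide it. *)
Lemma val_powD_eq (w : discrete_valuation F) n i y A j : 0 < i -> ~~ (p %| j)%N ->
  val_eq w n y -> val_eq w (n + i) A -> val_eq w (n * j%:Z + i) ((y + A) ^+ j - y ^+ j).
Proof.
move=> i_gt0 pj wy wA; have y0 := val_eq_neq0 wy.
have wu : val_eq w i (A / y).
  by have := val_eqM wA (val_eqV wy); rewrite addrAC subrr add0r.
have [R DR wR] := val_exp1D j i_gt0 (val_ge_eq wu).
have -> : (y + A) ^+ j - y ^+ j = y ^+ j * ((1 + A / y) ^+ j - 1).
  by rewrite mulrBr mulr1 -exprMn mulrDr mulr1 mulrCA divff ?mulr1.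
rewrite DR val_eqM //; first by rewrite mulrC val_eqX.
by rewrite val_eqD // -[i]add0r val_eqM ?val_eq_nat.
Qed.

Lemma val_eq_AS (w : discrete_valuation F) n a :
  n < 0 -> val_eq w n (a ^+ p - a) -> exists2 m, n = p%:Z * m & val_eq w m a.
Proof.
move=> n_lt0 wn; have /andP[pr_p _] := charF; have p1 := prime_gt1 pr_p.
have a0 : a != 0.
  by apply: contraTneq wn => ->; rewrite expr0n gtn_eqF ?(ltnW p1) // subrr /val_eq eqxx.
have wa := val_eq_val w a0; exists (w a) => //.
have wa_lt0 : w a < 0.
  rewrite ltNge; apply/negP => wa_ge0.
  have wa0 : val_ge w 0 a by apply: val_geW (val_ge_eq wa).
  have : val_ge w 0 (a ^+ p - a).
    by apply: val_geB => //; have := val_geX p wa0; rewrite mulr0.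
  rewrite (val_eqE_ge _ wn); lia.
apply: val_eq_inj wn _; apply: val_eqD (val_eqX p wa) _.
by rewrite val_geN; apply: val_geW (val_ge_eq wa); nia.
Qed.

Lemma val_eq_AS0 (w : discrete_valuation F) a :
  val_eq w 0 (a ^+ p - a) -> val_eq w 0 a.
Proof.
move=> wn; have /andP[pr_p _] := charF; have p1 := prime_gt1 pr_p.
have a0 : a != 0.
  by apply: contraTneq wn => ->; rewrite expr0n gtn_eqF ?(ltnW p1) // subrr /val_eq eqxx.
have wa := val_eq_val w a0; rewrite /val_eq a0; apply/eqP.
have [wa_lt0|wa_gt0|//] := ltrgtP (w a) 0.
  have : val_eq w (p%:Z * w a) (a ^+ p - a).
    by rewrite val_eqD ?val_eqX // val_geN; apply: val_geW (val_ge_eq wa); nia.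
  by move/(val_eq_inj wn); nia.
have wa1 : val_ge w 1 a by apply: val_geW (val_ge_eq wa).
have : val_ge w 1 (a ^+ p - a).
  by apply: val_geB => //; apply: val_geW (val_geX p wa1); lia.
by rewrite (val_eqE_ge _ wn).
Qed.

End FrobeniusLemmas.

(** * One Artin-Schreier step: completeness, residues, lifted automorphisms *)

Section ArtinSchreierStep.
Variables (p : nat) (M L : fieldType) (w : discrete_valuation M).
Variables (wL : discrete_valuation L) (B : nat) (beta : M).
Variables (iota : {rmorphism M -> L}) (y : L).
Local Notation f := (AS_poly p beta).
Let ev (h : {poly M}) := (map_poly iota h).[y].

Hypotheses (charM : p \in [pchar M]) (B_gt0 : (0 < B)%N) (pB : ~~ (p %| B)%N).
Hypothesis w_beta : val_eq w (- B%:Z) beta.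
Hypothesis ev_surj : forall x : L, exists2 h : {poly M}, (size h <= p)%N & ev h = x.
Hypothesis ev_eq0 : forall h, (ev h == 0) = (f %| h).
Hypothesis wLP : forall n (h : {poly M}), (size h <= p)%N ->
  val_ge wL n (ev h) <-> poly_ge w p B n h.

Let pr_p : prime p. Proof. by case/andP: charM. Qed.
Let p1 : (1 < p)%N. Proof. exact: prime_gt1. Qed.

Let evD g h : ev (g + h) = ev g + ev h. Proof. by rewrite /ev rmorphD hornerD. Qed.
Let evB g h : ev (g - h) = ev g - ev h.
Proof. by rewrite /ev rmorphB hornerD hornerN. Qed.
Let evM g h : ev (g * h) = ev g * ev h. Proof. by rewrite /ev rmorphM hornerM. Qed.
Let evC c : ev c%:P = iota c. Proof. by rewrite /ev map_polyC hornerC. Qed.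
Let evX : ev 'X = y. Proof. by rewrite /ev map_polyX hornerX. Qed.
Let evXn j : ev 'X^j = y ^+ j. Proof. by rewrite /ev map_polyXn hornerXn. Qed.
Let evZ c j : ev (c *: 'X^j) = iota c * y ^+ j.
Proof. by rewrite -mul_polyC evM evC evXn. Qed.

Lemma AS_root : y ^+ p - y = iota beta.
Proof.
have : ev f == 0 by rewrite ev_eq0 dvdpp.
by rewrite /AS_poly !evB evXn evX evC subr_eq0 => /eqP.
Qed.

Let size_monom c j : (j < p)%N -> (size (c *: 'X^j : {poly M}) <= p)%N.
Proof. by move=> jp; rewrite (leq_trans (size_scale_leq _ _)) // size_polyXn. Qed.

Lemma val_ge_monom n c j : (j < p)%N -> val_ge wL n (iota c * y ^+ j) = coef_ge w p B n j c.
Proof.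
move=> jp; rewrite -evZ; apply/idP/idP => [|wc].
  by case/(wLP _ (size_monom c jp))/(_ j)=> //; rewrite coefZ coefXn eqxx mulr1.
by apply/(wLP _ (size_monom c jp))/poly_ge_monom.
Qed.

Lemma val_eq_monom n c j : (j < p)%N ->
  val_eq wL n (iota c * y ^+ j) = (c != 0) && (coef_weight w p B j c == n).
Proof.
move=> jp; rewrite val_eq_andN !val_ge_monom // /coef_ge; case: eqVneq => //= _; lia.
Qed.

Lemma val_eq_iota n c : val_eq w n c -> val_eq wL (p%:Z * n) (iota c).
Proof.
case/andP=> c0 /eqP wc; rewrite -[iota c]mulr1 -(expr0 y) val_eq_monom ?(ltnW p1) //.
by rewrite c0 /coef_weight wc /=; lia.
Qed.

Lemma val_ge_iota n c : val_ge w n c -> val_ge wL (p%:Z * n) (iota c).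
Proof.
have [->|c0] := eqVneq c 0; first by rewrite rmorph0.
rewrite (val_eqE_ge _ (val_eq_val w c0)) (val_eqE_ge _ (val_eq_iota (val_eq_val w c0))).
by rewrite ler_pM2l //; lia.
Qed.

Lemma val_eq_AS_root : val_eq wL (- B%:Z) y.
Proof.
rewrite -[y]mul1r -(rmorph1 iota) -[y in _ * y]expr1 val_eq_monom // oner_neq0 /=.
by rewrite /coef_weight dval1; lia.
Qed.

Lemma AS_lead_term x : x != 0 -> exists c j x1,
  [/\ (j < p)%N, c != 0, x = iota c * y ^+ j + x1,
      coef_weight w p B j c = wL x & val_ge wL (wL x + 1) x1].
Proof.
move=> x0; have [h sh Dx] := ev_surj x.
have h0 : h != 0.
  by apply: contraNneq x0 => h0; rewrite -Dx h0 /ev rmorph0 horner0.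
have [n [j [jp hj0 wj wh wh1]]] := poly_weight_ex pr_p B_gt0 pB w_beta h0 sh.
have sz1 : (size (h - h`_j *: 'X^j)%R <= p)%N.
  by apply: leq_trans (size_polyD _ _) _; rewrite size_polyN geq_max sh size_monom.
have w1 : val_ge wL (n + 1) (x - iota h`_j * y ^+ j).
  by rewrite -Dx -evZ -evB; apply/(wLP _ sz1).
have wn : val_eq wL n (iota h`_j * y ^+ j) by rewrite val_eq_monom // hj0 wj eqxx.
have wx : wL x = n.
  by apply: val_eqK; rewrite -[x](subrK (iota h`_j * y ^+ j)) val_eqDl.
by exists h`_j, j, (x - iota h`_j * y ^+ j); rewrite wx addrC subrK.
Qed.

Lemma AS_coordinates x : exists2 c : 'I_p -> M, x = \sum_(j < p) iota (c j) * y ^+ j &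
  forall n, val_ge wL n x -> forall j : 'I_p, coef_ge w p B n j (c j).
Proof.
have [h sh Dx] := ev_surj x; exists (fun j : 'I_p => h`_j).
  rewrite -Dx /ev (@horner_coef_wide _ p) ?(leq_trans (size_poly _ _)) //.
  by apply: eq_bigr => j _; rewrite coef_map.
by move=> n; rewrite -Dx => /(wLP _ sh) wh j; apply: wh.
Qed.

(** Without the coefficient of degree 0 only monomials y^j with 0 < j < p remain, and their weights
    are prime to p. This serves to show that fixed elements lie in M: a part of valuation prime to p
    is moved by an exactly known amount. *)
Lemma AS_decomposition x : exists c x0,
  x = iota c + x0 /\ (x0 != 0 -> ~~ (p%:Z %| wL x0)%Z).
Proof.
have [h sh Dx] := ev_surj x; pose h0 := h - (h`_0)%:P.
have sz0 : (size h0 <= p)%N.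
  apply: leq_trans (size_polyD _ _) _; rewrite size_polyN geq_max sh.
  by rewrite (leq_trans (size_polyC_leq1 _)) ?prime_gt0.
exists h`_0, (ev h0); split=> [|x0]; first by rewrite -evC -evD addrC subrK.
have h0_neq0 : h0 != 0.
  by apply: contraNneq x0 => ->; rewrite /ev rmorph0 horner0.
have [n [j [jp hj0 wj wh _]]] := poly_weight_ex pr_p B_gt0 pB w_beta h0_neq0 sz0.
have j_gt0 : (0 < j)%N.
  by rewrite lt0n; apply: contraNneq hj0 => ->; rewrite coefB coefC eqxx subrr.
have [wn1 wn2] := poly_eqP pr_p B_gt0 pB w_beta hj0 wj wh.
have wn : val_eq wL n (ev h0).
  by rewrite val_eq_andN; apply/andP; split; [apply/(wLP _ sz0) | apply/negP => /(wLP _ sz0)].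
rewrite (val_eqK wn) -wj /coef_weight; apply/negP => pn.
have : (p%:Z %| (B * j)%N%:Z)%Z.
  have := dvdz_mulr (w h0`_j) (dvdzz p%:Z).
  by move/rpredB/(_ pn); rewrite opprB addrC subrK PoszM.
by rewrite dvdzE /= Euclid_dvdM // (negbTE pB) gtnNdvd.
Qed.

Lemma AS_val_complete : val_complete w -> val_complete wL.
Proof.
move=> wC u uC.
have [c Du wc] : exists2 c : nat -> 'I_p -> M,
    forall n, u n = \sum_(j < p) iota (c n j) * y ^+ j &
    forall m n k, val_ge wL k (u m - u n) -> forall j : 'I_p, coef_ge w p B k j (c m j - c n j).
  have hP n : exists h : {poly M}, (size h <= p)%N && (ev h == u n).
    by have [h sh /eqP Dh] := ev_surj (u n); exists h; rewrite sh.
  pose h n := xchoose (hP n); have /all_and2[sh Dh] n := andP (xchooseP (hP n)).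
  exists (fun n (j : 'I_p) => (h n)`_j) => [n|m n k].
    rewrite -(eqP (Dh n)) /ev (@horner_coef_wide _ p) ?(leq_trans (size_poly _ _)) //.
    by apply: eq_bigr => j _; rewrite coef_map.
  rewrite -(eqP (Dh m)) -(eqP (Dh n)) -evB => /wLP wh j.
  have sz : (size (h m - h n)%R <= p)%N.
    by apply: leq_trans (size_polyD _ _) _; rewrite size_polyN geq_max !sh.
  by rewrite -coefB; apply: (wh sz).
have l_ex (j : 'I_p) : exists l : M, forall n : int, exists N : nat, forall i : nat,
    (N <= i)%N -> val_ge w n (c i j - l).
  apply: wC => n; have [N uN] := uC (p%:Z * n); exists N => a b Na Nb.
  have := wc _ _ _ (uN a b Na Nb) j; rewrite /coef_ge /val_ge /coef_weight.
  case: eqVneq => //= _ le; have p0 : 0 < p%:Z by rewrite ltz_nat prime_gt0.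
  by rewrite -(ler_pM2l p0); apply: le_trans le _; rewrite gerBl.
have [l lP] := fin_all_exists l_ex.
exists (\sum_(j < p) iota (l j) * y ^+ j) => n.
(* The factor y^j costs B j < p B, which the extra B in the precision of each coordinate repays
   after multiplication by p. *)
have [N NP] := fin_all_exists (fun j => lP j (`|n| + B%:Z)).
exists (\max_j N j) => i Ni; rewrite Du -sumrB; apply: val_ge_sum => j _.
rewrite -mulrBl -rmorphB val_ge_monom //.
have := NP j i (leq_trans (leq_bigmax j) Ni); rewrite /coef_ge /val_ge /coef_weight.
case: eqVneq => //= _ le; have jp := ltn_ord j; have p0 := prime_gt0 pr_p.
have n_le : n <= `|n| by rewrite ler_norm.
have n_ge0 : 0 <= `|n| by [].
by move: le n_le n_ge0; move: (w _) `|n| => W a le n_le n_ge0; clear -le n_le n_ge0 jp p0; nia.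
Qed.

(** The dominant monomial of a unit has weight 0, which forces degree 0, so the residue field does
    not grow. [R] stands for membership in K. *)
Lemma AS_residue (R : M -> Prop) :
  (forall c, val_eq w 0 c -> exists2 k, R k & val_ge w 1 (c - k)) ->
  forall x, val_eq wL 0 x -> exists2 k, R k & val_ge wL 1 (x - iota k).
Proof.
move=> wR x wx; have [c [j [x1 [jp c0 Dx wj w1]]]] := AS_lead_term (val_eq_neq0 wx).
rewrite (val_eqK wx) in wj w1.
have j0 : j = 0%N.
  apply: (coef_weight_inj pr_p B_gt0 pB w_beta (w := w) (c := c) (d := 1)) => //; first exact: ltnW.
  by rewrite wj /coef_weight dval1; lia.
have wc : val_eq w 0 c.
  rewrite /val_eq c0; move: wj; rewrite /coef_weight j0 mulr0 subr0 => /eqP.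
  by rewrite mulf_eq0 eqz_nat gtn_eqF // ltnW.
have [k Rk wk] := wR c wc; exists k => //.
rewrite Dx j0 expr0 mulr1 addrAC -rmorphB val_geD //.
by apply: val_geW (val_ge_iota wk); rewrite mulr1 lez_nat prime_gt0.
Qed.

Section Lift.
Variables (r : {rmorphism M -> M}) (a : M).
Hypothesis a_AS : a ^+ p - a = r beta - beta.

(** The image y + a is a root of X^p - X - r(beta), as (y + a)^p - (y + a) = beta + (r(beta) -
    beta). *)
Lemma AS_lift : exists s : {rmorphism L -> L},
  (forall c, s (iota c) = iota (r c)) /\ s y = y + iota a.
Proof.
have charL : p \in [pchar L] by rewrite (fmorph_pchar iota).
have commr : commr_rmorph (iota \o r) (y + iota a) by move=> x; apply: mulrC.
pose ev' : {poly M} -> L := horner_morph commr.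
have ev'f : ev' f = 0.
  rewrite /ev' !rmorphB /= rmorphXn /= !horner_morphX horner_morphC /=.
  rewrite (FrobD charL) -(subrK beta (r beta)) -a_AS rmorphD rmorphB rmorphXn -AS_root; ring.
have ev'E g h : ev g = ev h -> ev' g = ev' h.
  move/eqP; rewrite -subr_eq0 -evB ev_eq0 => /dvdpP[q Dq].
  by apply/eqP; rewrite -subr_eq0 /ev' -rmorphB Dq rmorphM /= -/ev' ev'f mulr0.
have hP x : exists h : {poly M}, ev h == x.
  by have [h _ /eqP] := ev_surj x; exists h.
pose s x := ev' (xchoose (hP x)).
have sE h : s (ev h) = ev' h by apply/ev'E/eqP/(xchooseP (hP (ev h))).
have sB : zmod_morphism s.
  move=> x1 x2; have [h1 _ <-] := ev_surj x1; have [h2 _ <-] := ev_surj x2.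
  by rewrite -evB !sE /ev' rmorphB.
have sM : monoid_morphism s.
  have ev1 : ev 1 = 1 by rewrite /ev rmorph1 hornerC.
  split=> [|x1 x2]; first by rewrite -ev1 sE /ev' rmorph1 ev1.
  have [h1 _ <-] := ev_surj x1; have [h2 _ <-] := ev_surj x2.
  by rewrite -evM !sE /ev' rmorphM.
pose sR : {rmorphism L -> L} := HB.pack s (GRing.isZmodMorphism.Build _ _ s sB)
  (GRing.isMonoidMorphism.Build _ _ s sM).
exists sR; split=> [c|] /=; first by rewrite -evC sE /ev' horner_morphC.
have -> : s y = ev' 'X by rewrite -sE evX.
by rewrite /ev' horner_morphX.
Qed.

End Lift.

Section LiftRamification.
Variables (s : {rmorphism L -> L}) (r : {rmorphism M -> M}) (a : M) (i : int).
Hypotheses (s_iota : forall c, s (iota c) = iota (r c)) (s_y : s y = y + iota a).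
Hypothesis (i_gt0 : 0 < i).
Hypothesis r_ge : forall n c, val_ge w n c -> val_ge w (n + i) (r c - c).
Hypothesis w_a : val_eq wL (- B%:Z + i) (iota a).

(** Moving the coefficient c gains p i in valuation, since w is scaled by p, whereas moving y^j
    gains only i. The second change therefore dominates, and it is exact when 0 < j < p. *)
Let val_lift_monom c j n : (j < p)%N -> coef_ge w p B n j c ->
  val_ge wL (n + i) (s (iota c * y ^+ j) - iota c * y ^+ j) /\
  (c != 0 -> coef_weight w p B j c = n -> (0 < j)%N ->
   val_eq wL (n + i) (s (iota c * y ^+ j) - iota c * y ^+ j)).
Proof.
move=> jp wc; have charL : p \in [pchar L] by rewrite (fmorph_pchar iota).
have wy := val_eq_AS_root; have wya : val_eq wL (- B%:Z) (y + iota a).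
  by rewrite val_eqD // (val_eqE_ge _ w_a) lerD2l; move: i_gt0; clear; lia.
have -> : s (iota c * y ^+ j) - iota c * y ^+ j =
    iota c * ((y + iota a) ^+ j - y ^+ j) + iota (r c - c) * (y + iota a) ^+ j.
  by rewrite rmorphM rmorphXn s_iota s_y rmorphB /=; ring.
have [->|c0] := eqVneq c 0; first by rewrite !rmorph0 subrr rmorph0 !mul0r addr0.
have wc' := val_eq_iota (val_eq_val w c0).
move: wc; rewrite /coef_ge (negbTE c0) /= => wc.
have w2 : val_ge wL (n + i + 1) (iota (r c - c) * (y + iota a) ^+ j).
  apply: val_geW (val_geM (val_ge_iota (r_ge (val_ge_val w c))) (val_ge_eq (val_eqX j wya))).
  move: wc i_gt0 p1; rewrite /coef_weight; clear; move: (w c) => W wc i0 p1; nia.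
split=> [|_ wcn j_gt0].
  apply: val_geD; last by apply: val_geW w2; rewrite lerDl.
  apply: val_geW (val_geM (val_ge_eq wc') (val_powD_ge charL j i_gt0 wy (val_ge_eq w_a))).
  by move: wc; rewrite /coef_weight; clear; lia.
apply: val_eqD => //.
have pj : ~~ (p %| j)%N by rewrite gtnNdvd.
have := val_eqM wc' (val_powD_eq charL i_gt0 pj wy w_a).
by rewrite -wcn /coef_weight mulNr -addrA.
Qed.

Lemma val_ge_lift n x : val_ge wL n x -> val_ge wL (n + i) (s x - x).
Proof.
have [c Dx wc] := AS_coordinates x; move/wc=> {}wc.
rewrite Dx rmorph_sum -sumrB; apply: val_ge_sum => j _.
by have [] := val_lift_monom (ltn_ord j) (wc j).
Qed.

Lemma val_eq_lift n x : ~~ (p%:Z %| n)%Z -> val_eq wL n x ->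
  val_eq wL (n + i) (s x - x).
Proof.
move=> pn wx; have [c [j [x1 [jp c0 Dx wj w1]]]] := AS_lead_term (val_eq_neq0 wx).
rewrite (val_eqK wx) in wj w1.
have j_gt0 : (0 < j)%N.
  rewrite lt0n; apply: contra pn => /eqP j0; apply/dvdzP; exists (w c).
  by rewrite -wj j0 /coef_weight mulr0 subr0 mulrC.
have wc : coef_ge w p B n j c by rewrite /coef_ge wj lexx orbT.
have [_ /(_ c0 wj j_gt0) w2] := val_lift_monom jp wc.
rewrite Dx rmorphD opprD addrACA val_eqD //.
by apply: val_geW (val_ge_lift w1); rewrite (addrAC n 1).
Qed.

End LiftRamification.

End ArtinSchreierStep.

(** * Towers of Artin-Schreier extensions *)

Section GaloisKernel.
Variables (K : fieldType) (gT : finGroupType) (E : {group gT}) (N : {set gT}).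
Variables (M : splittingFieldType K) (phi : gT -> gal_of {:M}).
Hypotheses (sub : N \subset E) (phiM : {in E &, {morph phi : e e' / e * e'}%g}).
Hypothesis ker : {in E, forall e, (phi e == 1%g) = (e \in N)}.
Let f : {morphism E >-> gal_of {:M}} := Morphism phiM.

Lemma gal_ker_morph : ('ker f = N)%g.
Proof.
apply/setP=> e; apply/idP/idP => [|Ne].
  by case/morphpreP=> Ee /set1P/eqP; rewrite ker.
have Ee := subsetP sub e Ne.
by apply/morphpreP; split=> //; apply/set1P/eqP; rewrite ker.
Qed.

Lemma gal_ker_group_set : group_set N.
Proof. by rewrite -gal_ker_morph groupP. Qed.

Lemma gal_ker_normal : (N <| E)%g.
Proof. by rewrite -gal_ker_morph ker_normal. Qed.

Lemma gal_ker_card : galois 1 {:M} -> (forall g, exists2 e, e \in E & phi e = g) ->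
  #|E| = (#|N| * \dim {:M})%N.
Proof.
move=> galM surj; have imf : (f @* E = [set: gal_of {:M}])%g.
  apply/setP=> g; rewrite inE; have [e Ee <-] := surj g.
  exact: (mem_morphim f).
have := galois_dim galM.
rewrite dimv1 divn1 galT -imf card_morphim setIid => ->.
by rewrite -{1}gal_ker_morph Lagrange //; apply/subsetP=> e /morphpreP[].
Qed.

End GaloisKernel.

Section Tower.
Variables (p : nat) (K : fieldType) (v : discrete_valuation K).
Hypothesis charK : p \in [pchar K].

Record galois_cover (gT : finGroupType) (E : {group gT}) (N : {set gT})
    (M : splittingFieldType K) (phi : gT -> gal_of {:M}) : Prop := GaloisCover {
  cover_sub : N \subset E;
  cover_galois : galois 1 {:M};
  cover_morph : {in E &, {morph phi : e e' / e * e'}%g};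
  cover_ker : {in E, forall e, (phi e == 1%g) = (e \in N)};
  cover_surj : forall g, exists2 e, e \in E & phi e = g
}.

(* E acts on M through phi with kernel N; ram e is the ramification number
   i(phi e), and bs lists the lower breaks with multiplicity. *)
Record tower (gT : finGroupType) (E : {group gT}) (N : {set gT})
    (M : splittingFieldType K) (w : discrete_valuation M)
    (phi : gT -> gal_of {:M}) (ram : gT -> nat) (bs : seq nat) : Prop := Tower {
  tower_cover :> galois_cover E N phi;
  tower_ramified : totally_ramified v w;
  tower_complete : val_complete w;
  tower_residue : forall x, val_eq w 0 x -> exists k : K, val_ge w 1 (x - k%:A);
  tower_ram_gt0 : {in E :\: N, forall e, (0 < ram e)%N};
  tower_ram_ge : {in E :\: N, forall e n x,
     val_ge w n x -> val_ge w (n + (ram e)%:Z) (phi e x - x)};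
  tower_ram_eq : {in E :\: N, forall e n x, ~~ (p%:Z %| n)%Z ->
     val_eq w n x -> val_eq w (n + (ram e)%:Z) (phi e x - x)};
  tower_card_ram : forall b : nat,
    #|[set e in E | (e \in N) || (b <= ram e)%N]| = (#|N| * p ^ count (leq b) bs)%N;
  tower_sorted : sorted leq bs;
  tower_breaks_gt0 : all (leq 1) bs
}.

Section CoverFacts.
Variables (gT : finGroupType) (E : {group gT}) (N : {set gT}).
Variables (M : splittingFieldType K) (phi : gT -> gal_of {:M}).
Hypothesis T : galois_cover E N phi.

Lemma cover_group_set : group_set N.
Proof. exact: gal_ker_group_set (cover_sub T) (cover_morph T) (cover_ker T). Qed.

Lemma cover_normal : (N <| E)%g.
Proof. exact: gal_ker_normal (cover_sub T) (cover_morph T) (cover_ker T). Qed.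

Lemma cover_card : #|E| = (#|N| * \dim {:M})%N.
Proof.
apply: gal_ker_card (cover_sub T) (cover_morph T) (cover_ker T) _ (cover_surj T).
exact: cover_galois T.
Qed.

Lemma cover_fixed x : {in E, forall e, phi e x = x} -> exists k : K, x = k%:A.
Proof.
move=> fx; apply/vlineP; have /galois_fixedField <- := cover_galois T.
apply/fixedFieldP; first exact: memvf.
by move=> g _; have [e Ee <-] := cover_surj T g; apply: fx.
Qed.

Lemma cover_ker_id e x : e \in N -> phi e x = x.
Proof.
move=> Ne; have Ee := subsetP (cover_sub T) e Ne.
by have := cover_ker T Ee; rewrite Ne => /eqP->; rewrite gal_id.
Qed.

Lemma cover_act e e' x : e \in E -> e' \in E -> phi (e * e')%g x = phi e' (phi e x).
Proof. by move=> Ee Ee'; rewrite (cover_morph T) // galM ?memvf. Qed.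

End CoverFacts.

Section TowerFacts.
Variables (gT : finGroupType) (E : {group gT}) (N : {set gT}).
Variables (M : splittingFieldType K) (w : discrete_valuation M).
Variables (phi : gT -> gal_of {:M}) (ram : gT -> nat) (bs : seq nat).
Hypothesis T : tower E N w phi ram bs.

Lemma tower_dim : \dim {:M} = (p ^ size bs)%N.
Proof.
have N0 : (0 < #|N|)%N.
  by apply/card_gt0P; exists 1%g; case/group_setP: (cover_group_set T).
have /eqP := tower_card_ram T 0; rewrite (_ : [set e in E | _] = E); last first.
  by apply/setP=> e; rewrite inE orbT andbT.
rewrite (cover_card T) eqn_pmul2l // => /eqP->; congr (p ^ _)%N.
Qed.

Lemma tower_ram_bound B : all (fun b => (b <= B)%N) bs ->
  {in E :\: N, forall e, (ram e <= B)%N}.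
Proof.
move=> bsB e /setDP[Ee nNe]; rewrite leqNgt; apply/negP => lt_B.
have := tower_card_ram T B.+1; rewrite (_ : count _ _ = 0%N) ?expn0 ?muln1; last first.
  rewrite (@eq_in_count _ _ pred0) ?count_pred0 // => b /(allP bsB) /= bB.
  by rewrite leqNgt ltnS bB.
move=> cardN; have : e |: N \subset [set e in E | (e \in N) || (B < ram e)%N].
  apply/subsetP=> e'; rewrite !inE => /orP[/eqP->|Ne']; first by rewrite Ee lt_B orbT.
  by rewrite Ne' (subsetP (cover_sub T)).
by move/subset_leq_card; rewrite cardN cardsU1 nNe ltnn.
Qed.

End TowerFacts.
End Tower.

Section TowerStep.
Variables (p : nat) (K : fieldType) (v : discrete_valuation K).
Hypothesis charK : p \in [pchar K].
Variables (gT : finGroupType) (E : {group gT}) (N : {set gT}).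
Variables (M : splittingFieldType K) (w : discrete_valuation M).
Variables (phi : gT -> gal_of {:M}) (ram : gT -> nat) (bs : seq nat).
Hypothesis T : tower p v E N w phi ram bs.

Variables (a : gT -> M) (beta : M) (B : nat).
Hypotheses (B_gt0 : (0 < B)%N) (pB : ~~ (p %| B)%N).
Hypothesis w_beta : val_eq w (- B%:Z) beta.
Hypothesis bs_le : all (fun b => (b <= B)%N) bs.
Hypothesis aM : {in E &, forall e e', a (e * e')%g = phi e' (a e) + a e'}.
Hypothesis a_AS : {in E, forall e, a e ^+ p - a e = phi e beta - beta}.
Hypothesis a_neq0 : exists2 z, z \in N & a z != 0.

Let pr_p : prime p. Proof. by case/andP: charK. Qed.
Let charM : p \in [pchar M]. Proof. by rewrite pchar_lalg. Qed.

(** As p does not divide B, [tower_ram_eq] applies to [beta]: the element (a e)^p - a e has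
    valuation ram e - B <= 0, which is then p times that of a e. Over L this is the valuation of
    iota (a e), exactly the shift of y for which the lift of e keeps the number ram e. *)
Lemma step_val_a e : e \in E -> e \notin N -> exists2 m : int,
  p%:Z * m = - B%:Z + (ram e)%:Z & val_eq w m (a e).
Proof.
move=> Ee nNe; have ENe : e \in E :\: N by rewrite inE nNe.
have ram_le := tower_ram_bound T bs_le ENe.
have pnB : ~~ (p%:Z %| - B%:Z)%Z by rewrite dvdzE abszN.
have := tower_ram_eq T ENe pnB w_beta; rewrite -a_AS // => w_AS.
have [lt0|ge0] := ltrP (- B%:Z + (ram e)%:Z) 0.
  by have [m -> wm] := val_eq_AS charM lt0 w_AS; exists m.
have E0 : - B%:Z + (ram e)%:Z = 0 by lia.
exists 0; rewrite ?mulr0 //; rewrite E0 in w_AS.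
exact: (val_eq_AS0 charM w_AS).
Qed.

Lemma step_a_ker e : e \in N -> a e ^+ p = a e.
Proof.
move=> Ne; have Ee := subsetP (cover_sub T) e Ne.
by apply/eqP; rewrite -subr_eq0 a_AS // (cover_ker_id T) // subrr.
Qed.

(** Outside N the ramification numbers persist by [step_val_a]. For e in N, a e equals its p-th
    power; if it is nonzero it is a unit, so e moves y, of valuation - B, by a unit and has number
    B. *)
Lemma tower_step : exists (L : splittingFieldType K) (wL : discrete_valuation L)
    (phi' : gT -> gal_of {:L}) (iota : {rmorphism M -> L}) (y : L),
  [/\ tower p v E [set e in N | a e == 0] wL phi'
        (fun e => if e \in N then B else ram e) (rcons bs B),
      forall k : K, iota k%:A = k%:A,
      y ^+ p - y = iota beta /\ val_eq wL (- B%:Z) y,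
      (forall n x, val_eq w n x -> val_eq wL (p%:Z * n) (iota x)) /\
      (forall n x, val_ge w n x -> val_ge wL (p%:Z * n) (iota x)) &
      {in E, forall e, (forall x, phi' e (iota x) = iota (phi e x)) /\
                       phi' e y = y + iota (a e)}].
Proof.
have p1 := prime_gt1 pr_p.
have [L0 [iota [y [wL [iotaK dimL ev_surj ev_eq0 wLP]]]]] :=
  AS_tower_extension pr_p B_gt0 pB w_beta.
have charL0 : p \in [pchar L0] by rewrite pchar_lalg.
have y_root := AS_root ev_eq0.
have wy := val_eq_AS_root charM B_gt0 pB w_beta wLP.
have w_iota := val_eq_iota charM B_gt0 pB w_beta wLP.
have wge_iota := val_ge_iota charM B_gt0 pB w_beta wLP.
pose N' := [set e in N | a e == 0]; pose ram' e := if e \in N then B else ram e.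
have lift_ex e : exists s : L0 -> L0, e \in E ->
  exists r : {rmorphism L0 -> L0}, [/\ r =1 s, forall c, s (iota c) = iota (phi e c)
     & s y = y + iota (a e)].
  have [Ee|nEe] := boolP (e \in E); last by exists id.
  have [s [s1 s2]] := AS_lift charM ev_surj ev_eq0 (a_AS Ee).
  by exists s => _; exists s.
have [s sP] := fin_all_exists lift_ex.
have s_iota e c : e \in E -> s e (iota c) = iota (phi e c).
  by move=> Ee; have [r [_ ->]] := sP e Ee.
have s_y e : e \in E -> s e y = y + iota (a e).
  by move=> Ee; have [r [_ _ ->]] := sP e Ee.
have ext (r1 r2 : {rmorphism L0 -> L0}) :
    (forall c, r1 (iota c) = r2 (iota c)) -> r1 y = r2 y -> r1 =1 r2.
  move=> r12 r12y x; have [h _ <-] := ev_surj x.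
  by rewrite -!horner_map -!map_poly_comp r12y (eq_map_poly r12).
have ramP e : e \in E :\: N' -> 0 < (ram' e)%:Z /\
    (forall n c, val_ge w n c -> val_ge w (n + (ram' e)%:Z) (phi e c - c)) /\
    val_eq wL (- B%:Z + (ram' e)%:Z) (iota (a e)).
  case/setDP=> Ee; rewrite /ram' inE; have [Ne /= ae0|nNe _] := boolP (e \in N).
    split; first by rewrite ltz_nat.
    split=> [n c _|]; first by rewrite (cover_ker_id T) // subrr.
    rewrite addNr -(mulr0 p%:Z); apply: w_iota.
    exact: (val_eq_Frob _ p1 ae0 (step_a_ker Ne)).
  have ENe : e \in E :\: N by rewrite inE nNe.
  split; first by rewrite ltz_nat (tower_ram_gt0 T ENe).
  split; first exact: (tower_ram_ge T ENe).
  by have [m <- wm] := step_val_a Ee nNe; apply: w_iota.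
have s_ge e n x : e \in E :\: N' -> val_ge wL n x -> val_ge wL (n + (ram' e)%:Z) (s e x - x).
  move=> eN'; have [Ee _] := setDP eN'; have [r [rs _ _]] := sP e Ee.
  have [gt0 [r_ge w_a]] := ramP e eN'; rewrite -rs.
  apply: (val_ge_lift charM B_gt0 pB w_beta ev_surj wLP _ _ gt0 r_ge w_a) => [c|].
    by rewrite rs s_iota.
  by rewrite rs s_y.
have s_eq e n x : e \in E :\: N' -> ~~ (p%:Z %| n)%Z -> val_eq wL n x ->
    val_eq wL (n + (ram' e)%:Z) (s e x - x).
  move=> eN' pn; have [Ee _] := setDP eN'; have [r [rs _ _]] := sP e Ee.
  have [gt0 [r_ge w_a]] := ramP e eN'; rewrite -rs.
  apply: (val_eq_lift charM B_gt0 pB w_beta ev_surj wLP _ _ gt0 r_ge w_a) => // [c|].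
    by rewrite rs s_iota.
  by rewrite rs s_y.
have sM : {in E &, forall e e' x, s (e * e')%g x = s e' (s e x)}.
  move=> e e' Ee Ee' x.
  have [r [rs _ _]] := sP e Ee; have [r' [rs' _ _]] := sP e' Ee'.
  have [r2 [rs2 _ _]] := sP (e * e')%g (groupM Ee Ee').
  rewrite -rs2 -rs' -rs; apply: (ext r2 (r' \o r)) => [c|] /=.
    by rewrite rs rs' rs2 !s_iota ?groupM // (cover_act T).
  rewrite rs rs' rs2 !s_y ?groupM // -rs' rmorphD /= rs' s_y // rs' s_iota // aM //.
  by rewrite rmorphD /= [in RHS]addrAC addrA.
have act_s : field_action E s.
  split=> // [e Ee|x x_fix].
    have [r [rs _ _]] := sP e Ee; exists r => // k x.
    rewrite -mulr_algl rmorphM rs -iotaK s_iota // rmorph_alg iotaK.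
    by rewrite mulr_algl.
  (* A fixed x lies in M, because z is trivial on M and moves every nonzero element of valuation
     prime to p. Being fixed by E inside M, it then lies in K. *)
  have [z Nz az] := a_neq0; have Ez := subsetP (cover_sub T) z Nz.
  have zN' : z \in E :\: N' by rewrite !inE Ez andbT (negbTE az) andbF.
  have [c Dx] : exists c, x = iota c.
    have [c [x0 [Dx px0]]] := AS_decomposition charM B_gt0 pB w_beta ev_surj wLP x.
    have [x00|x00] := eqVneq x0 0; first by exists c; rewrite Dx x00 addr0.
    have := s_eq z _ _ zN' (px0 x00) (val_eq_val wL x00).
    rewrite -(canLR (addKr _) Dx); have [r [rs _ _]] := sP z Ez.
    rewrite -rs rmorphD rmorphN !rs s_iota // (cover_ker_id T) // x_fix // subrr.
    by rewrite /val_eq eqxx.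
  have [k Dc] : exists k : K, c = k%:A.
    apply: (cover_fixed T) => e Ee; apply: (fmorph_inj iota).
    by rewrite -s_iota // -Dx x_fix.
  by apply/vlineP; exists k; rewrite Dx Dc iotaK.
have splitL := field_action_splitting act_s.
pose L : splittingFieldType K := HB.pack L0 (FieldExt_isSplittingField.Build K L0 splitL).
have [phi' [galL phi'E phi'M phi'surj]] := @field_action_gal K gT E L s act_s.
exists L, wL, phi', iota, y; split=> //; last first.
  by move=> e Ee; rewrite !phi'E // s_y //; split=> // x; rewrite phi'E // s_iota.
have sub' : N' \subset E.
  by apply: subset_trans (cover_sub T); apply/subsetP=> e; rewrite inE => /andP[].
have ker' : {in E, forall e, (phi' e == 1%g) = (e \in N')}.
  move=> e Ee; rewrite inE; apply/eqP/andP => [phi1|[Ne /eqP ae]].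
      have se x : s e x = x by rewrite -phi'E // phi1 gal_id.
      split; last by have /eqP := se y; rewrite s_y // -subr_eq0 addrAC subrr add0r fmorph_eq0.
      rewrite -(cover_ker T) //; apply/gal_eqP => c _.
      by rewrite gal_id; apply: (fmorph_inj iota); rewrite -s_iota // se.
  apply/eqP/gal_eqP => x _; rewrite gal_id phi'E //.
  have [r [rs _ _]] := sP e Ee; rewrite -rs.
  apply: (ext r idfun) => [c|] /=; rewrite rs ?s_iota ?s_y ?ae ?rmorph0 ?addr0 //.
  by rewrite (cover_ker_id T).
have cardN : #|N| = (p * #|N'|)%N.
  have /eqP := gal_ker_card sub' phi'M ker' galL phi'surj.
  rewrite dimL (cover_card T) mulnA eqn_pmul2r ?adim_gt0 // => /eqP->.
  by rewrite mulnC.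
split; first by split.
- split=> [|k k0]; first by rewrite dimL muln_gt0 prime_gt0 // adim_gt0.
  have [_ ram_w] := tower_ramified T; rewrite dimL -iotaK.
  have wk : val_eq w (w k%:A) k%:A by apply: val_eq_val; rewrite scaler_eq0 oner_eq0 orbF.
  by rewrite (val_eqK (w_iota _ _ wk)) ram_w // [in RHS]mulnC mulrnA -[RHS]mulr_natl natz.
- exact: AS_val_complete charM ev_surj wLP (tower_complete T).
- move=> x wx; pose R (c : M) := exists k : K, c = k%:A.
  have wR c : val_eq w 0 c -> exists2 k, R k & val_ge w 1 (c - k).
    by move=> wc; have [k wk] := tower_residue T wc; exists k%:A => //; exists k.
  have [_ [k ->] wk] := AS_residue charM B_gt0 pB w_beta ev_surj wLP wR wx.
  by exists k; rewrite -iotaK.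
- by move=> e eN'; have [? _] := ramP e eN'.
- by move=> e eN' n x wx; rewrite phi'E ?s_ge //; case/setDP: eN'.
- by move=> e eN' n x pn wx; rewrite phi'E ?s_eq //; case/setDP: eN'.
- move=> b; rewrite -cats1 count_cat /= addn0.
  have N'N e : e \in N' -> e \in N by rewrite inE => /andP[].
  (* For b <= B the set is the old one, and the new factor p comes from |N| = p |N'|; for b > B only
     the new kernel remains. *)
  have [bB|Bb] := leqP b B.
    rewrite addn1 expnS mulnA (mulnC _ p) -cardN -(tower_card_ram T); congr #|pred_of_set _|.
    apply/setP=> e; rewrite !inE /ram'; case: (e \in E) => //=.
    by case: (e \in N); rewrite /= ?bB ?orbT.
  rewrite addn0 (_ : count _ _ = 0%N) ?expn0 ?muln1; last first.
    rewrite (@eq_in_count _ _ pred0) ?count_pred0 // => c /(allP bs_le) /= cB.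
    by rewrite leqNgt (leq_ltn_trans cB).
  congr #|pred_of_set _|; apply/setP=> e; rewrite inE /ram'.
  have [eN'|neN'] := boolP (e \in N'); first by rewrite (subsetP sub') ?orbT.
  have [Ee|//] := boolP (e \in E); rewrite /= leqNgt.
  have [Ne|nNe] := boolP (e \in N); first by rewrite Bb.
  by rewrite (leq_ltn_trans _ Bb) // (tower_ram_bound T bs_le) // inE nNe.
- move: bs_le (tower_sorted T); case: (bs) => //= b bs' /andP[bB bs'B].
  rewrite rcons_path => -> /=.
  have /allP := bs'B; case/lastP: (bs') => //= l c.
  by rewrite last_rcons; apply; rewrite mem_rcons mem_head.
- by rewrite all_rcons B_gt0 (tower_breaks_gt0 T).
Qed.

End TowerStep.

(** * Crossed homomorphisms *)

Section CrossedHomomorphisms.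
Variables (K : fieldType) (gT : finGroupType) (E : {group gT}) (N : {set gT}).
Variables (M : splittingFieldType K) (phi : gT -> gal_of {:M}).
Hypothesis T : galois_cover E N phi.
Local Open Scope group_scope.

Definition crossed (a : gT -> M) :=
  {in E &, forall e e', a (e * e')%g = phi e' (a e) + a e'}%R.

(** Independence of automorphisms gives an element of nonzero trace; the trace lies in K, so it can
    be scaled to 1. *)
Lemma cover_trace1 : exists theta : M, (\sum_(g : gal_of {:M}) g theta = 1)%R.
Proof.
have [x _ /= tr_neq0] := @gal_independent_contra _ _ {:M} predT (fun=> 1%R) 1%g isT (oner_neq0 _).
have [k Dk] : exists k : K, (\sum_(g : gal_of {:M}) 1%R * g x)%R = k%:A%R.
  apply: (cover_fixed T) => e Ee; rewrite rmorph_sum [RHS](reindex_inj (mulIg (phi e))) /=.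
  by apply: eq_bigr => g _; rewrite !mul1r galM ?memvf.
have k0 : (k != 0)%R by apply: contraNneq tr_neq0 => k0; rewrite Dk k0 scale0r.
exists (k^-1 *: x)%R.
rewrite (eq_bigr (fun g : gal_of {:M} => k^-1 *: (1 * g x))%R); last first.
  by move=> g _; rewrite linearZ mul1r.
by rewrite -scaler_sumr Dk scalerA mulVf ?scale1r.
Qed.

Lemma cover_section : exists g : gal_of {:M} -> gT,
  forall tau, g tau \in E /\ phi (g tau) = tau.
Proof.
have ex (tau : gal_of {:M}) : exists e, e \in E /\ phi e = tau.
  by have [e Ee De] := cover_surj T tau; exists e.
exact: (fin_all_exists ex).
Qed.

Lemma cover_phi_eq e e' : e \in E -> e' \in E -> phi e = phi e' -> (e * e'^-1)%g \in N.
Proof.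
move=> Ee Ee' De; rewrite -(cover_ker T) ?groupM ?groupV //.
rewrite -(inj_eq (mulIg (phi e'))) -(cover_morph T) ?groupM ?groupV //.
by rewrite mulgKV mul1g De.
Qed.

(** As c vanishes on N it descends to the Galois group; the classical witness is minus the sum of
    c(tau) tau(theta), with theta of trace 1. *)
Lemma additive_Hilbert90 (c : gT -> M) : crossed c -> {in N, forall e, c e = 0%R} ->
  exists b : M, {in E, forall e, c e = phi e b - b}%R.
Proof.
move=> cM cN; have [theta tr1] := cover_trace1; have [g gP] := cover_section.
have c_phi e e' : e \in E -> e' \in E -> phi e = phi e' -> c e = c e'.
  move=> Ee Ee' De; have Nn := cover_phi_eq Ee Ee' De.
  have En := subsetP (cover_sub T) _ Nn.
  by rewrite -{1}(mulgKV e' e) cM // cN // rmorph0 add0r.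
exists (- \sum_tau c (g tau) * tau theta)%R => e Ee.
rewrite rmorphN rmorph_sum /= opprK.
have -> : c e = (\sum_tau c e * (tau * phi e)%g theta)%R.
  rewrite -mulr_sumr -[LHS]mulr1 -tr1 [in LHS](reindex_inj (mulIg (phi e))) //.
rewrite [X in (_ + X)%R](reindex_inj (mulIg (phi e))) /= addrC -sumrB.
apply: eq_bigr => tau _; have [Eg Dg] := gP tau; have [Eg' Dg'] := gP (tau * phi e)%g.
have := cM _ _ Eg Ee; rewrite (c_phi _ _ (groupM Eg Ee) Eg'); last first.
  by rewrite (cover_morph T) // Dg Dg'.
by move=> ->; rewrite rmorphM galM ?memvf //= -mulrBl addrAC subrr add0r.
Qed.

(* Extending lam along coset representatives is multiplicative up to a
   2-cocycle with values in M; averaging against an element of trace 1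
   splits it. *)
Lemma crossed_extension (lam : gT -> M) :
  {in N &, {morph lam : n n' / (n * n')%g >-> (n + n')%R}} ->
  {in N & E, forall n e, lam (n ^ e) = lam n} ->
  {in N & E, forall n e, phi e (lam n) = lam n} ->
  exists2 a : gT -> M, crossed a & {in N, a =1 lam}.
Proof.
move=> lamM lamJ lam_fix; have [theta tr1] := cover_trace1; have [g gP] := cover_section.
have sNE := subsetP (cover_sub T); have nNE := normal_norm (cover_normal T).
pose N0 := Group (cover_group_set T).
have N0M x y : x \in N -> y \in N -> (x * y)%g \in N by apply: (@groupM _ N0).
have lam1 : lam 1%g = 0%R.
  have := lamM 1%g 1%g (group1 N0) (group1 N0); rewrite mulg1 => /eqP.
  by rewrite -subr_eq0 opprD addrA subrr add0r oppr_eq0 => /eqP.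
pose k x := lam ((g (phi x))^-1 * x)%g.
have kN x : x \in E -> ((g (phi x))^-1 * x)%g \in N.
  move=> Ex; have [Eg Dg] := gP (phi x).
  rewrite -(cover_ker T) ?groupM ?groupV // -(inj_eq (mulgI (phi (g (phi x))))).
  by rewrite -(cover_morph T) ?groupM ?groupV // mulKVg mulg1 Dg.
have kg tau : k (g tau) = 0%R by rewrite /k; have [_ ->] := gP tau; rewrite mulVg.
have kMN x n : x \in E -> n \in N -> k (x * n)%g = (k x + lam n)%R.
  move=> Ex Nn; have En := sNE n Nn; rewrite /k (cover_morph T) //.
  have /eqP -> : phi n == 1%g by rewrite (cover_ker T).
  by rewrite mulg1 mulgA lamM ?kN.
pose a e := (\sum_tau k (g tau * e)%g * (tau * phi e)%g theta)%R.
exists a => [e e' Ee Ee'|n Nn]; last first.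
  have En := sNE n Nn; have /eqP phi1 : phi n == 1%g by rewrite (cover_ker T).
  rewrite /a (eq_bigr (fun tau : gal_of {:M} => lam n * tau theta)%R) => [|tau _].
    by rewrite -mulr_sumr tr1 mulr1.
  by have [Eg _] := gP tau; rewrite kMN // kg add0r phi1 mulg1.
rewrite {2}/a [X in (_ + X)%R](reindex_inj (mulIg (phi e))) /= addrC.
rewrite /a rmorph_sum -big_split /=; apply: eq_bigr => tau _.
have [Eg Dg] := gP tau; have [Eg' Dg'] := gP (tau * phi e)%g.
have -> : (tau * phi (e * e'))%g theta = (tau * phi e * phi e')%g theta.
  by rewrite (cover_morph T) // mulgA.
have galE : (tau * phi e * phi e')%g theta = phi e' ((tau * phi e)%g theta).
  by rewrite galM ?memvf.
rewrite rmorphM /= -galE mulgA -mulrDl; congr (_ * _)%R.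
have Ege : (g tau * e)%g \in E by rewrite groupM.
have Dge : phi (g tau * e)%g = (tau * phi e)%g by rewrite (cover_morph T) // Dg.
have Dk : k (g tau * e)%g = lam ((g (tau * phi e)%g)^-1 * (g tau * e))%g.
  by rewrite /k Dge.
have Nn : ((g (tau * phi e)%g)^-1 * (g tau * e))%g \in N by rewrite -Dge kN.
set n := (_ * (g tau * e))%g in Dk Nn.
(* Replacing g(tau) e by the chosen representative costs n in N, which passes e' by conjugation;
   [lamJ] makes this conjugation invisible. *)
have Ekey : (g tau * e * e')%g = (g (tau * phi e)%g * e' * n ^ e')%g.
  by rewrite -[RHS]mulgA -conjgC /n !mulgA mulgV mul1g.
rewrite Dk lam_fix // Ekey kMN ?groupM ?memJ_norm ?(subsetP nNE) // lamJ //.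
Qed.

End CrossedHomomorphisms.

(** * Embedding problems with large breaks *)

Lemma residue_perfectP (p : nat) (K : fieldType) (v : discrete_valuation K) :
  p \in [pchar K] -> perfect (residue_field v) ->
  forall x, val_eq v 0 x -> exists k, val_ge v 1 (x - k ^+ p).
Proof.
move=> charK perf x vx.
have res0 (a : val_int v) : (\pi_(residue_field v) a == 0)%qT = val_ge v 1 (val_int_val a).
  by rewrite -(rmorph0 (\pi_(residue_field v))%qT) -Quotient.idealrBE subr0.
have charR : p \in [pchar (residue_field v)].
  have /andP[pr_p /eqP p0] := charK; rewrite inE pr_p /=.
  rewrite -(rmorph_nat (\pi_(residue_field v))%qT) res0.
  have -> : val_int_val (p%:R : val_int v) = p%:R by exact: (rmorph_nat (val : val_int v -> K)).
  rewrite p0.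
  exact: val_ge0r.
have x_int : x \in val_ring v by rewrite unfold_in; apply: val_ge_eq.
have [y] := perf p charR (\pi_(residue_field v) (ValInt x_int))%qT.
elim/quotW: y => b /eqP; rewrite -rmorphXn -subr_eq0 -rmorphB res0 /= => vb.
have Db : val_int_val (ValInt x_int - b ^+ p) = x - val_int_val b ^+ p.
  by rewrite -[LHS]/(val (ValInt x_int - b ^+ p)) rmorphB rmorphXn.
by exists (val_int_val b); rewrite -Db.
Qed.

(** * Approximation by p-th powers *)

Section PthPowerApproximation.
Variables (p : nat) (M : fieldType) (w : discrete_valuation M).
Hypothesis charM : p \in [pchar M].
Hypothesis w_perfect : forall x, val_eq w 0 x -> exists k, val_ge w 1 (x - k ^+ p).

Lemma perfect_approx n x : val_eq w (p%:Z * n) x ->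
  exists2 d, val_eq w n d & val_ge w (p%:Z * n + 1) (x - d ^+ p).
Proof.
have /andP[pr_p _] := charM; have p0 := prime_gt0 pr_p.
move=> wx; have [c wc] := uniformizer_exp w n.
have wcp := val_eqX p wc; have cp0 := val_eq_neq0 wcp.
have wu : val_eq w 0 (x / c ^+ p) by rewrite -(subrr (p%:Z * n)) val_eqM ?val_eqV.
have [k wk] := w_perfect wu; exists (c * k).
  rewrite -[n]addr0 val_eqM //.
  have k0 : k != 0.
    apply: contraTneq wk => ->; rewrite expr0n gtn_eqF // subr0.
    by rewrite (val_eqE_ge _ wu).
  have : val_eq w 0 (k ^+ p).
    rewrite -[k ^+ p](subKr (x / c ^+ p)) val_eqD // val_geN //.
  move/(val_eq_inj (val_eqX p (val_eq_val w k0))) => /eqP.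
  by rewrite mulf_eq0 eqz_nat gtn_eqF //= /val_eq k0.
have -> : x - (c * k) ^+ p = c ^+ p * (x / c ^+ p - k ^+ p).
  by rewrite mulrBr mulrCA divff // mulr1 exprMn.
by rewrite val_geM // val_ge_eq.
Qed.

(* If every difference x - z^p had valuation divisible by p, the p-th roots
   could be improved forever and would converge to a p-th root of x. *)
Lemma nonpower_approx x : val_complete w -> (forall z, x != z ^+ p) ->
  exists z, ~~ (p%:Z %| w (x - z ^+ p))%Z.
Proof.
have /andP[pr_p _] := charM; have p0 := prime_gt0 pr_p.
move=> wC xP; apply: NNPP => no_z.
have pdvd z : exists n, w (x - z ^+ p) = p%:Z * n.
  have /dvdzP[q Dq] : (p%:Z %| w (x - z ^+ p))%Z.
    by apply/idPn => nz; apply: no_z; exists z.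
  by exists q; rewrite Dq mulrC.
have x_neq z : x - z ^+ p != 0 by rewrite subr_eq0.
have stepP z : exists d, (w (x - z ^+ p) < w (x - (z + d) ^+ p)) &&
    val_ge w (w (x - z ^+ p) %/ p)%Z d.
  have [n Dn] := pdvd z; have wz := val_eq_val w (x_neq z); rewrite Dn in wz.
  have [d wd wxd] := perfect_approx wz; exists d.
  rewrite (val_eqK wz) [X in (X %/ _)%Z]mulrC mulzK ?eqz_nat ?gtn_eqF // (val_ge_eq wd) andbT.
  rewrite (FrobD charM) opprD addrA.
  have := val_eq_val w (x_neq (z + d)); rewrite (FrobD charM) opprD addrA => wd'.
  by move: wxd; rewrite (val_eqE_ge _ wd') lezD1.
pose next z := z + xchoose (stepP z); pose u n := iter n next 0.
have uS n : u n.+1 = u n + xchoose (stepP (u n)) by [].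
have u_lt n : w (x - u n ^+ p) < w (x - u n.+1 ^+ p).
  by rewrite uS; case/andP: (xchooseP (stepP (u n))).
pose c0 := w (x - u 0%N ^+ p).
have u_ge n : c0 + n%:Z <= w (x - u n ^+ p).
  by elim: n => [|n IHn]; [rewrite addr0 | have := u_lt n; lia].
have u_step n : val_ge w ((c0 + n%:Z) %/ p)%Z (u n.+1 - u n).
  rewrite uS addrAC subrr add0r; case/andP: (xchooseP (stepP (u n))) => _.
  by apply: val_geW; apply: lez_pdiv2r => //; exact: u_ge.
have u_diff k n : val_ge w ((c0 + n%:Z) %/ p)%Z (u (n + k)%N - u n).
  elim: k => [|k IHk]; first by rewrite addn0 subrr.
  rewrite addnS -(subrK (u (n + k)%N) (u _.+1)) -addrA val_geD //.
  by apply: val_geW (u_step _); apply: lez_pdiv2r => //; lia.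
have [l lP] : exists l : M, forall n : int, exists N : nat, forall i : nat,
    (N <= i)%N -> val_ge w n (u i - l).
  apply: wC => n; exists (absz (p%:Z * n - c0)%R) => i j Ni Nj.
  wlog le_ij : i j Ni Nj / (i <= j)%N.
    move=> IH; have [/IH|/ltnW/IH] := leqP i j; first exact.
    by rewrite -val_geN opprB; apply.
  rewrite -val_geN opprB -(subnKC le_ij); apply: val_geW (u_diff _ _).
  by rewrite lez_divRL; lia.
have : x - l ^+ p = 0.
  apply: (@val_ge_trivial _ w) => n.
  have [N NP] := lP `|n|; pose m := maxn N (absz (n - c0)%R).
  have -> : x - l ^+ p = (x - u m ^+ p) + (u m - l) ^+ p by rewrite (FrobB charM); ring.
  apply: val_geD; first by rewrite (val_eqE_ge _ (val_eq_val w (x_neq _))); have := u_ge m; lia.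
  apply: val_geW (val_geX p (NP m (leq_maxl _ _))); nia.
by move/eqP; rewrite (negbTE (x_neq l)).
Qed.

End PthPowerApproximation.

Lemma mem_leq_sumn (s : seq nat) x : x \in s -> (x <= sumn s)%N.
Proof.
elim: s => //= y s IHs; rewrite inE => /predU1P[->|/IHs xs]; first exact: leq_addr.
exact: leq_trans xs (leq_addl _ _).
Qed.

Section LargeBreak.
Variables (p : nat) (K : fieldType) (v : discrete_valuation K).
Hypothesis charK : p \in [pchar K].
Hypothesis v_perfect : forall x, val_eq v 0 x -> exists k, val_ge v 1 (x - k ^+ p).
Variables (gT : finGroupType) (E : {group gT}) (N : {set gT}).
Variables (M : splittingFieldType K) (w : discrete_valuation M).
Variables (phi : gT -> gal_of {:M}) (ram : gT -> nat) (bs : seq nat).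
Hypothesis T : tower p v E N w phi ram bs.

Let pr_p : prime p. Proof. by case/andP: charK. Qed.
Let charM : p \in [pchar M]. Proof. by rewrite pchar_lalg. Qed.

Let algX (k : K) n : (k ^+ n)%:A = k%:A ^+ n :> M.
Proof. exact: (rmorphXn (in_alg M)). Qed.
Let algB (k l : K) : (k - l)%:A = k%:A - l%:A :> M.
Proof. exact: (rmorphB (in_alg M)). Qed.
Let algM (k l : K) : (k * l)%:A = k%:A * l%:A :> M.
Proof. exact: (rmorphM (in_alg M)). Qed.

Lemma tower_val_eq n (k : K) : val_eq v n k -> val_eq w (n * (\dim {:M})%:Z) k%:A.
Proof.
case/andP=> k0 /eqP vk; have [_ ram_w] := tower_ramified T.
by rewrite /val_eq scaler_eq0 oner_eq0 orbF k0 ram_w // vk -mulr_natr natz eqxx.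
Qed.

Lemma tower_val_ge n (k : K) : val_ge v n k -> val_ge w (n * (\dim {:M})%:Z) k%:A.
Proof.
have [->|k0] := eqVneq k 0; first by rewrite scale0r.
have vk := val_eq_val v k0; rewrite (val_eqE_ge _ vk) (val_eqE_ge _ (tower_val_eq vk)).
by move=> nk; rewrite ler_wpM2r.
Qed.

Lemma tower_dim_gt0 : (0 < \dim {:M})%N.
Proof. by rewrite (tower_dim T) expn_gt0 prime_gt0. Qed.

Lemma tower_perfect x : val_eq w 0 x -> exists k, val_ge w 1 (x - k ^+ p).
Proof.
have d0 := tower_dim_gt0; move=> wx; have [k wk] := tower_residue T wx.
have wkA : val_eq w 0 k%:A.
  by rewrite -[_%:A](subKr x) val_eqD // val_geN.
have vk : val_eq v 0 k.
  have k0 : k != 0 by have := val_eq_neq0 wkA; rewrite scaler_eq0 oner_eq0 orbF.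
  have := val_eq_inj (tower_val_eq (val_eq_val v k0)) wkA => /eqP.
  by rewrite mulf_eq0 orbC eqz_nat gtn_eqF //= /val_eq k0.
have [l vl] := v_perfect vk; exists l%:A.
rewrite -(subrK k%:A x) -addrA val_geD // -algX -algB.
by apply: val_geW (tower_val_ge vl); lia.
Qed.

(** Taking p-th powers is injective in characteristic p, so a p-th root of k in M would be Galois
    invariant, hence in K, and v(k) would be divisible by p. *)
Lemma tower_non_power (k : K) : k != 0 -> ~~ (p%:Z %| v k)%Z -> forall z : M, k%:A != z ^+ p.
Proof.
move=> k0 pk z; apply: contraNneq pk => Dk.
have charI : injective (fun x : M => x ^+ p).
  move=> x y /= Exy; apply/eqP; rewrite -subr_eq0; apply: contraT => xy0.
  by have := expf_neq0 p xy0; rewrite (FrobB charM) Exy subrr eqxx.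
have [l Dz] : exists l : K, z = l%:A.
  apply: (cover_fixed T) => e Ee; apply: charI => /=.
  have <- : phi e (z ^+ p) = phi e z ^+ p by exact: rmorphXn.
  by rewrite -Dk rmorph_alg.
have {}Dk : k = l ^+ p.
  by apply: (fmorph_inj (in_alg M)); rewrite /= Dk Dz algX.
have l0 : l != 0.
  by apply: contraNneq k0 => l0; rewrite Dk l0 expr0n gtn_eqF // prime_gt0.
have := val_eqX p (val_eq_val v l0); rewrite -Dk => /val_eqK->.
exact: dvdz_mulr.
Qed.

(* These are the conditions under which y |-> y + a e lifts the action of E
   to the extension generated by a root y of X^p - X - b. *)
Definition AS_solution (a : gT -> M) (b : M) :=
  crossed E phi a /\ {in E, forall e, a e ^+ p - a e = phi e b - b}.

(** This is the change of root from y to y - c: the crossed homomorphism varies by a coboundary and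
    the extension stays the same. *)
Lemma AS_solution_sub a b (c : M) : AS_solution a b ->
  AS_solution (fun e => a e - (phi e c - c)) (b - (c ^+ p - c)).
Proof.
case=> aM a_AS; split=> [e e' Ee Ee'|e Ee].
  by rewrite aM // (cover_act T) // rmorphB rmorphB; ring.
have := a_AS e Ee; rewrite (FrobB charM) (FrobB charM) rmorphB rmorphB rmorphXn.
move=> E1; apply/eqP; rewrite -subr_eq0; apply/eqP; move/eqP: E1.
by rewrite -subr_eq0 => /eqP <-; ring.
Qed.

Lemma AS_solution_addK a b (k : K) : AS_solution a b -> AS_solution a (b + k%:A).
Proof.
by case=> aM a_AS; split=> // e Ee; rewrite rmorphD /= rmorph_alg a_AS //; ring.
Qed.

(** The uniformizer t of K may have valuation divisible by p in M, but it is not a p-th power there,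
    so some rho = t - z^p has valuation prime to p. Adding c^p t and removing (c z)^p - c z leaves
    c^p rho + c z + b, in which c^p rho dominates. *)
Lemma AS_large_break a b : AS_solution a b -> exists a' b' B,
  [/\ AS_solution a' b', {in N, a' =1 a}, (0 < B)%N /\ ~~ (p %| B)%N,
      val_eq w (- B%:Z) b' & all (fun c => (c <= B)%N) bs].
Proof.
move=> Sab; have [t t0 vt] := dval_surj v.
have pt : ~~ (p%:Z %| v t)%Z by rewrite vt dvdz1 /= gtn_eqF // prime_gt1.
have [z pz] := nonpower_approx charM tower_perfect (tower_complete T) (tower_non_power t0 pt).
set rho := _ - _ in pz.
have rho0 : rho != 0 by rewrite subr_eq0 tower_non_power.
have wrho := val_eq_val w rho0.
have d0 := tower_dim_gt0; set D := \dim {:M} in d0.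
have p1 := prime_gt1 pr_p.
(* Large enough for c^p rho to dominate b and c z, and for B to exceed all earlier breaks. *)
pose r := (absz (w rho) + absz (w b) + absz (w z) + sumn bs).+1.
have r_gt : (absz (w rho) + absz (w b) + absz (w z) + sumn bs < r)%N by [].
clearbody r; have [c vc] := uniformizer_exp v (- r%:Z).
pose X := (r * D)%N; have rX : (r <= X)%N by rewrite leq_pmulr.
have wc : val_eq w (- X%:Z) c%:A.
  by have := tower_val_eq vc; rewrite -/D mulNr -PoszM.
have pX : (2 * X <= p * X)%N by rewrite leq_mul2r p1 orbT.
pose B := absz (p%:Z * X%:Z - w rho)%R.
have DB : B%:Z = p%:Z * X%:Z - w rho.
  by rewrite /B; clear -rX pX r_gt; clearbody X; lia.
have wcr : val_eq w (- B%:Z) (c%:A ^+ p * rho).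
  by rewrite DB opprB addrC -mulrN val_eqM ?val_eqX.
have [B_gt b_gt z_gt] : [/\ (sumn bs < B)%N, - B%:Z + 1 <= w b & - B%:Z + 1 <= - X%:Z + w z].
  by move: (B) DB => B' DB; clear -DB rX pX r_gt; clearbody X; split; lia.
exists (fun e => a e - (phi e (c%:A * z) - c%:A * z)),
  (b + (c ^+ p * t)%:A - ((c%:A * z) ^+ p - c%:A * z)), B.
split; first exact: AS_solution_sub (AS_solution_addK _ Sab).
- by move=> e Ne; rewrite (cover_ker_id T) // subrr subr0.
- split.
    exact: leq_ltn_trans B_gt.
  apply: contra pz => pB; rewrite (_ : w rho = p%:Z * X%:Z - B%:Z); last first.
    by rewrite DB opprB addrC subrK.
  by rewrite rpredB // dvdz_mulr.
- have -> : b + (c ^+ p * t)%:A - ((c%:A * z) ^+ p - c%:A * z) =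
     c%:A ^+ p * rho + (b + c%:A * z).
    by rewrite algM algX /rho exprMn; ring.
  apply: val_eqD => //; apply: val_geD.
    exact: val_geW b_gt (val_ge_val w b).
  exact: val_geW z_gt (val_geM (val_ge_eq wc) (val_ge_val w z)).
by apply/allP=> x /mem_leq_sumn/leq_trans; apply; apply: ltnW.
Qed.

End LargeBreak.

Lemma natr_eq_mod (p : nat) (F : fieldType) (m n : nat) : p \in [pchar F] ->
  m = n %[mod p] -> m%:R = n%:R :> F.
Proof.
move=> charF mn; rewrite (divn_eq m p) (divn_eq n p) mn !natrD !natrM.
by rewrite (pcharf0 charF) !mulr0.
Qed.

(** * Central steps of order p in a p-group *)

Section CentralSteps.
Local Open Scope group_scope.

Lemma index_prime_subsetPn (p : nat) (gT : finGroupType) (N N' : {group gT}) :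
  prime p -> #|N : N'| = p -> exists2 z, z \in N & z \notin N'.
Proof.
move=> pr_p indN; apply/subsetPn; apply: contraL pr_p => sNN'.
by rewrite -indN (eqP (_ : #|N : N'| == 1%N)) // indexg_eq1.
Qed.

(** A discrete logarithm to the base z on the cyclic group N / N', with values in nat that matter
    only modulo p. Centrality of N / N' in E / N' gives the invariance under conjugation. *)
Lemma central_step_character (p : nat) (gT : finGroupType) (E N N' : {group gT}) (z : gT) :
  prime p -> N <| E -> N' <| E -> N' \subset N -> #|N : N'| = p -> [~: N, E] \subset N' ->
  z \in N -> z \notin N' ->
  exists j : gT -> nat,
  [/\ {in N &, forall n n', j (n * n') = (j n + j n')%N %[mod p]},
      {in N & E, forall n e, j (n ^ e) = j n %[mod p]},
      {in N, forall n, (p %| j n)%N = (n \in N')} &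
      {in N, forall n, z ^- j n * n \in N'}].
Proof.
move=> pr_p nNE nN'E sN'N indN cNE Nz nN'z.
have nN'N : N \subset 'N(N') by apply: subset_trans (normal_norm nN'E); apply: normal_sub.
have nN'z' := subsetP nN'N z Nz.
have cardQ : #|N / N'| = p by rewrite card_quotient.
set x := coset N' z; have Qx : x \in N / N' by apply: mem_quotient.
have ntx : x != 1 by apply: contraNneq nN'z => /coset_idr->.
have ox : #[x] = p.
  by apply/prime_nt_dvdP; rewrite ?order_eq1 // -cardQ order_dvdG.
have Dx : N / N' = <[x]>.
  by apply/eqP; rewrite eq_sym eqEcard cycle_subG Qx cardQ -orderE ox leqnn.
have ex n : exists i, n \in N -> coset N' n = x ^+ i.
  have [Nn|_] := boolP (n \in N); last by exists 0%N.
  have /cycleP[i Di] : coset N' n \in <[x]> by rewrite -Dx mem_quotient.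
  by exists i.
have [j jP] := fin_all_exists ex.
exists j; split=> [n n' Nn Nn'|n e Nn Ee|n Nn|n Nn].
- rewrite -ox; apply/eqP.
  rewrite -eq_expg_mod_order expgD -!jP ?groupM // morphM ?(subsetP nN'N) //.
- rewrite -ox; apply/eqP.
  have Nne : n ^ e \in N by rewrite memJ_norm // (subsetP (normal_norm nNE)).
  rewrite -eq_expg_mod_order -!jP //.
  have nN'n := subsetP nN'N n Nn; have nN'e := subsetP (normal_norm nN'E) e Ee.
  have -> : n ^ e = n * [~ n, e] by rewrite commgEl mulKVg.
  have N'c : [~ n, e] \in N' by apply: (subsetP cNE); rewrite mem_commg.
  have nN'c := subsetP (normG N') _ N'c.
  by rewrite (morphM (coset_morphism N') nN'n nN'c) /= (coset_id N'c) mulg1.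
- have nN'n := subsetP nN'N n Nn.
  rewrite -{1}ox order_dvdn -jP //.
  by apply/eqP/idP => [/coset_idr->//|/coset_id].
have nN'n := subsetP nN'N n Nn.
apply: coset_idr; first by rewrite groupM ?groupV ?groupX.
have -> : coset N' (z ^- j n * n) = (x ^+ j n)^-1 * coset N' n.
  rewrite (morphM (coset_morphism N')) ?groupV ?groupX //=.
  by rewrite (morphV (coset_morphism N')) ?groupX //= (morphX (coset_morphism N')).
by rewrite jP // mulVg.
Qed.

(** A nontrivial normal subgroup of the p-group E / N' meets the center; a subgroup of order p of
    the intersection is pulled back to E. *)
Lemma central_step_below (p : nat) (gT : finGroupType) (E N N' : {group gT}) :
  p.-group E -> N <| E -> N' <| E -> N' \proper N ->
  exists N1 : {group gT}, [/\ N1 <| E, N' \subset N1, N1 \subset N,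
     #|N1 : N'| = p & [~: N1, E] \subset N'].
Proof.
move=> pE nNE nN'E /andP[sN'N nsNN'].
have nN'N : N \subset 'N(N') by apply: subset_trans (normal_norm nN'E); apply: normal_sub.
have nilQ : nilpotent (E / N') by apply: (pgroup_nil (p := p)); apply: quotient_pgroup.
have ntQ : N / N' != 1 by rewrite -subG1 quotient_sub1.
have ntZ := meet_center_nil nilQ (quotient_normal N' nNE) ntQ.
have pZ : p.-group (N / N' :&: 'Z(E / N')).
  apply: pgroupS (subset_trans (subsetIr _ _) (center_sub _)) _.
  exact: quotient_pgroup.
have [pr_p pdiv _] := pgroup_pdiv pZ ntZ.
have [x /setIP[Qx Zx] ox] := Cauchy pr_p pdiv.
pose N1 := (coset N' @*^-1 <[x]>)%G.
have sN'N1 : N' \subset N1 by apply: sub_cosetpre.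
have DN1 : N1 / N' = <[x]> by apply: cosetpreK.
have nN'N1 : N1 \subset 'N(N') by apply: subsetIl.
exists N1; split=> //.
- rewrite -(quotientGK nN'E) cosetpre_normal.
  by apply: sub_center_normal; rewrite cycle_subG.
- by rewrite sub_cosetpre_quo ?cycle_subG // /normal sN'N.
- by rewrite -card_quotient // DN1.
rewrite -(quotient_cents2 nN'N1 (normal_norm nN'E)) DN1 cycle_subG.
by case/setIP: Zx.
Qed.

End CentralSteps.

(** * Solving central embedding problems one after another *)

Section Realizability.
Variables (p : nat) (K : fieldType) (v : discrete_valuation K).
Hypothesis charK : p \in [pchar K].
Hypothesis v_perfect : forall x, val_eq v 0 x -> exists k, val_ge v 1 (x - k ^+ p).

Definition realizable (gT : finGroupType) (E : {group gT}) (N : {set gT}) (bs : seq nat) :=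
  exists (M : splittingFieldType K) (w : discrete_valuation M)
    (phi : gT -> gal_of {:M}) (ram : gT -> nat), tower p v E N w phi ram bs.

(** On N the crossed homomorphism extending the discrete logarithm has values in F_p, so a^p - a
    vanishes there and Hilbert 90 makes it the coboundary of some b. *)
Lemma cover_central_solution (gT : finGroupType) (E N N' : {group gT})
    (M : splittingFieldType K) (phi : gT -> gal_of {:M}) :
  galois_cover E N phi -> (N' <| E)%g -> N' \subset N -> #|N : N'|%g = p ->
  ([~: N, E] \subset N')%g ->
  exists a b, [/\ AS_solution p E phi a b, {in N, forall n, (a n == 0) = (n \in N')} &
                  {in N, forall n, exists k : nat, a n = k%:R}].
Proof.
move=> T nN'E sN'N indN cNE.
have charM : p \in [pchar M] by rewrite pchar_lalg.
have /andP[pr_p _] := charK; have [z Nz nN'z] := index_prime_subsetPn pr_p indN.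
have [j [jM jJ jN' _]] := central_step_character pr_p (cover_normal T) nN'E sN'N indN cNE Nz nN'z.
have [|||a aM aN] := crossed_extension T (lam := fun n => (j n)%:R).
- by move=> n n' Nn Nn'; rewrite -natrD; apply/(natr_eq_mod charM)/jM.
- by move=> n e Nn Ee; apply/(natr_eq_mod charM)/jJ.
- by move=> n e _ _; rewrite rmorph_nat.
pose c e := a e ^+ p - a e.
have [||b Db] := additive_Hilbert90 T (c := c).
- move=> e e' Ee Ee'; rewrite /c aM // (FrobD charM) rmorphB rmorphXn /=; ring.
- by move=> n Nn; rewrite /c aN // (Frob_nat charM) subrr.
exists a, b; split=> // n Nn; first by rewrite aN // -(dvdn_pcharf charM) jN'.
by exists (j n); rewrite aN.
Qed.

Lemma realizable_central (gT : finGroupType) (E N N' : {group gT}) bs :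
  realizable E N bs -> (N' <| E)%g -> N' \subset N -> #|N : N'|%g = p ->
  ([~: N, E] \subset N')%g -> exists B, realizable E N' (rcons bs B).
Proof.
move=> [M [w [phi [ram T]]]] nN'E sN'N indN cNE; have /andP[pr_p _] := charK.
have [a [b [Sab aN _]]] := cover_central_solution T nN'E sN'N indN cNE.
have [a' [b' [B [[aM' a_AS'] a'N [B0 pB] wB bsB]]]] := AS_large_break charK v_perfect T Sab.
have [z Nz nN'z] := index_prime_subsetPn pr_p indN.
have a'z : exists2 z, z \in N & a' z != 0.
  by exists z => //; rewrite a'N // aN.
have [L [wL [phi' [_ [_ [T' _ _ _ _]]]]]] := tower_step charK T B0 pB wB bsB aM' a_AS' a'z.
exists B, L, wL, phi', (fun e => if e \in N then B else ram e).
rewrite (_ : (N' : {set gT}) = [set e in N | a' e == 0]) //.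
apply/setP=> e; rewrite inE; have [Ne|nNe] := boolP (e \in N); first by rewrite a'N // aN.
by apply/negbTE; apply: contra nNe; apply: subsetP.
Qed.

Lemma realizable_chain (gT : finGroupType) (E N N' : {group gT}) bs :
  (p.-group E)%g -> realizable E N bs -> (N <| E)%g -> (N' <| E)%g -> N' \subset N ->
  exists s, realizable E N' (bs ++ s).
Proof.
move=> pE rN nNE; have [m] := ubnP (#|N| - #|N'|); elim: m => // m IHm in N' *.
rewrite ltnS => le_m nN'E sN'N.
have [sNN'|nsNN'] := boolP (N \subset N').
  exists [::]; rewrite cats0; have <- : N = N' :> {set gT} by apply/eqP; rewrite eqEsubset sNN'.
  exact: rN.
have prN : N' \proper N by rewrite properE sN'N.
have [N1 [nN1E sN'N1 sN1N indN1 cN1]] := central_step_below pE nNE nN'E prN.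
have /andP[pr_p _] := charK.
have ltN1 : (#|N'| < #|N1|)%N.
  by rewrite -(Lagrange sN'N1) indN1 ltn_Pmulr ?prime_gt1.
have [|s rN1] := IHm N1 _ nN1E sN1N.
  move: le_m ltN1 (subset_leq_card sN1N); move: #|N| #|N1| #|N'| => a b c; clear; lia.
have [B rN'] := realizable_central rN1 nN'E sN'N1 indN1 cN1.
by exists (rcons s B); rewrite -rcons_cat.
Qed.

Lemma realizable_trivial (gT : finGroupType) (E : {group gT}) :
  val_complete v -> realizable E E [::].
Proof.
move=> vC; pose M : splittingFieldType K := K^o.
have M1 (x : M) : x \in 1%VS by rewrite -(regular_fullv K) memvf.
have act : @field_action K gT E M (fun _ => id).
  by split=> // e _; exists idfun.
have [phi [galM phiE phiM phi_surj]] := field_action_gal act.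
pose w : discrete_valuation M :=
  @DiscreteValuation M (dval_fun v) (@dvalM K v) (@dvalD K v) (dval_surj v).
exists M, w, phi, (fun=> 0%N); split=> //.
- split=> // e Ee; rewrite Ee; apply/gal_eqP => x _.
  by rewrite gal_id phiE.
- split=> [|k k0]; first exact: adim_gt0.
  rewrite (regular_fullv K) dimv1 mulr1n; congr (dval_fun v _); exact: mulr1.
- move=> x _; exists x; rewrite (_ : x - _ = 0) ?val_ge0r //.
  by rewrite [_%:A]mulr1 subrr.
- by move=> e; rewrite setDv inE.
- by move=> e; rewrite setDv inE.
- by move=> e; rewrite setDv inE.
move=> b; rewrite muln1; congr #|pred_of_set _|.
by apply/setP=> e; rewrite inE; case: (e \in E).
Qed.

End Realizability.

(** * Two successive breaks *)

Section BicyclicBreak.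
Variables (p : nat) (M L : fieldType) (w : discrete_valuation M) (wL : discrete_valuation L).
Variables (iota : {rmorphism M -> L}) (x1 : L) (gam : M) (b : nat).
Hypothesis charM : p \in [pchar M].
Hypothesis w_perfect : forall x, val_eq w 0 x -> exists k, val_ge w 1 (x - k ^+ p).
Hypothesis iota_eq : forall n x, val_eq w n x -> val_eq wL (p%:Z * n) (iota x).
Hypothesis iota_ge : forall n x, val_ge w n x -> val_ge wL (p%:Z * n) (iota x).
Hypotheses (b_gt0 : (0 < b)%N) (pb : ~~ (p %| b)%N).
Hypotheses (w_gam : val_eq w (- b%:Z) gam) (x1_root : x1 ^+ p - x1 = iota gam).
Hypothesis w_x1 : val_eq wL (- b%:Z) x1.

Let charL : p \in [pchar L]. Proof. by rewrite (fmorph_pchar iota). Qed.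
Let pr_p : prime p. Proof. by case/andP: charM. Qed.
(** The gap between the valuations of x1 and x1^p: the relative precision to which gam = x1^p - x1
    is a p-th power in L. *)
Let d : int := (p%:Z - 1) * b%:Z.

(* The leading term of beta has the form e^p gam^i with i < p, and gam^i =
   (x1^p - x1)^i differs from the p-th power x1^(pi) by an element of relative
   valuation d. *)
Lemma bicyclic_leading n beta : val_eq w n beta -> exists z beta1 eps,
  [/\ val_ge wL n z, val_ge w (n + 1) beta1, iota beta = z ^+ p + eps + iota beta1,
      val_ge wL (p%:Z * n + d) eps & ~~ (p%:Z %| n)%Z -> val_eq wL (p%:Z * n + d) eps].
Proof.
have p1 := prime_gt1 pr_p; move=> wbeta.
have [i [m [ip Dn]]] : exists i m, (i < p)%N /\ n = p%:Z * m - b%:Z * i%:Z.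
  have /coprimeP-/(_ b_gt0)[[u1 u2] /= Eu] : coprime b p by rewrite coprime_sym prime_coprime.
  pose i := absz (- (n * u1%:Z) %% p)%Z.
  have Di : i%:Z = (- (n * u1%:Z) %% p)%Z.
    by rewrite /i gez0_abs // modz_ge0 // eqz_nat gtn_eqF // ltnW.
  have /dvdzP[m Dm] : (p%:Z %| n + b%:Z * i%:Z)%Z.
    rewrite Di; apply/dvdzP.
    exists (- (n * u2%:Z) - b%:Z * (- (n * u1%:Z) %/ p)%Z).
    have := divz_eq (- (n * u1%:Z)) p; move: (_ %/ _)%Z (_ %% _)%Z => q r Er.
    have {}Er : r = - (n * u1%:Z) - q * p%:Z by rewrite Er addrC addKr.
    have Eub : u1%:Z * b%:Z = 1 + u2%:Z * p%:Z by lia.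
    rewrite Er (_ : b%:Z * _ = - n * (u1%:Z * b%:Z) - b%:Z * q * p%:Z); last by ring.
    by rewrite Eub; ring.
  exists i, m; split; last by lia.
  by rewrite -ltz_nat Di ltz_pmod // ltz_nat ltnW.
have gam0 := val_eq_neq0 w_gam; have wgi := val_eqX i w_gam.
have wq : val_eq w (p%:Z * m) (beta / gam ^+ i).
  have -> : p%:Z * m = n - i%:Z * - b%:Z by rewrite Dn; ring.
  exact: val_eqM wbeta (val_eqV wgi).
have [e we wq1] := perfect_approx charM w_perfect wq.
pose eps := iota e ^+ p * ((x1 ^+ p - x1) ^+ i - (x1 ^+ p) ^+ i).
have wep := val_eqX p (iota_eq we).
exists (iota e * x1 ^+ i), (beta - e ^+ p * gam ^+ i), eps.
have wxp := val_eqX p w_x1.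
have d_gt0 : 0 < d by rewrite /d mulr_gt0 ?subr_gt0 ?ltz_nat.
have wA : val_eq wL (p%:Z * - b%:Z + d) (- x1).
  by rewrite val_eqN (_ : _ + _ = - b%:Z) // /d; ring.
have Dd : p%:Z * (p%:Z * m) + (p%:Z * - b%:Z * i%:Z + d) = p%:Z * n + d by rewrite Dn; ring.
split.
- apply: val_ge_eq; rewrite Dn (_ : _ - _ = p%:Z * m + i%:Z * - b%:Z); last by ring.
  by apply: val_eqM (iota_eq we) (val_eqX i w_x1).
- have -> : beta - e ^+ p * gam ^+ i = gam ^+ i * (beta / gam ^+ i - e ^+ p).
    by rewrite mulrBr mulrCA divff ?expf_neq0 // mulr1 (mulrC (e ^+ p)).
  rewrite Dn (_ : _ + 1 = i%:Z * - b%:Z + (p%:Z * m + 1)); last by ring.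
  exact: val_geM (val_ge_eq wgi) wq1.
- rewrite rmorphB rmorphM !rmorphXn /= -x1_root /eps exprMn -!exprM (mulnC i p); ring.
- rewrite -Dd; exact: val_geM (val_ge_eq wep) (val_powD_ge charL i d_gt0 wxp (val_ge_eq wA)).
move=> pn; rewrite -Dd; apply: val_eqM wep (val_powD_eq charL d_gt0 _ wxp wA).
apply: contra pn => /dvdnP[q Dq]; rewrite Dn Dq PoszM.
by apply/dvdzP; exists (m - b%:Z * q%:Z); ring.
Qed.

(** Leading terms are removed one at a time. Each later error is at least as deep as the first bound
    p n + d, and the process stops at valuation 0; k bounds the number of steps. *)
Lemma bicyclic_remainder k n beta : 0 <= n + k%:Z -> val_ge w n beta ->
  exists2 z, val_ge wL n z & val_ge wL (Num.min (p%:Z * n + d) 0) (iota beta - z ^+ p).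
Proof.
have p0 := prime_gt0 pr_p.
elim: k => [|k IHk] in n beta * => nk wbeta.
  exists 0; rewrite ?val_ge0r // expr0n gtn_eqF // subr0.
  by apply: val_geW (iota_ge wbeta); rewrite ge_min mulr_ge0 ?orbT //; lia.
have IH beta' : val_ge w (n + 1) beta' -> exists2 z, val_ge wL n z &
    val_ge wL (Num.min (p%:Z * n + d) 0) (iota beta' - z ^+ p).
  move=> wb'; have [|z wz we] := IHk (n + 1) beta' _ wb'; first by lia.
  exists z; first by apply: val_geW wz; rewrite lerDl.
  by apply: val_geW we; rewrite le_min !ge_min lexx orbT andbT lerD2r ler_wpM2l // lerDl.
have [/IH//|nw] := boolP (val_ge w (n + 1) beta).
have wn : val_eq w n beta by rewrite val_eq_andN wbeta.
have [z0 [beta1 [eps [wz0 wb1 Db we _]]]] := bicyclic_leading wn.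
have [z1 wz1 we1] := IH _ wb1.
exists (z0 + z1); first exact: val_geD.
rewrite Db (FrobD charL).
have -> : z0 ^+ p + eps + iota beta1 - (z0 ^+ p + z1 ^+ p) = eps + (iota beta1 - z1 ^+ p) by ring.
by apply: val_geD => //; apply: val_geW we; rewrite ge_min lexx.
Qed.

(** As p does not divide B, the first error has valuation exactly - p B + (p - 1) b. The z
    subtracted along with z^p has valuation at least - B, which is strictly larger because b < B. *)
Lemma bicyclic_break B beta : (b < B)%N -> ~~ (p %| B)%N -> val_eq w (- B%:Z) beta ->
  exists z, val_eq wL (- (p * B - p.-1 * b)%N%:Z) (iota beta - (z ^+ p - z)).
Proof.
have p1 := prime_gt1 pr_p; move=> bB pB wbeta.
have [z0 [beta1 [eps [wz0 wb1 Db _ we]]]] := bicyclic_leading wbeta.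
have [|z1 wz1 we1] := @bicyclic_remainder B (- B%:Z + 1) beta1 _ wb1; first by rewrite addrAC addNr.
have Dt : - (p * B - p.-1 * b)%N%:Z = p%:Z * - B%:Z + d.
  rewrite -subzn; last by apply: leq_mul; [apply: leq_pred | apply: ltnW].
  by rewrite /d !PoszM predn_int ?prime_gt0 //; ring.
exists (z0 + z1); rewrite Dt Db (FrobD charL).
have -> : z0 ^+ p + eps + iota beta1 - (z0 ^+ p + z1 ^+ p - (z0 + z1)) =
  eps + ((iota beta1 - z1 ^+ p) + (z0 + z1)) by ring.
have d_lt : p%:Z * - B%:Z + d + 1 <= - B%:Z.
  rewrite lezD1 -subr_gt0 (_ : _ - _ = (p%:Z - 1) * (B%:Z - b%:Z)); last by rewrite /d; ring.
  by rewrite mulr_gt0 ?subr_gt0 ?ltz_nat.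
rewrite val_eqD ?we //; first by rewrite dvdzE abszN.
apply: val_geD.
  apply: val_geW we1; rewrite le_min; apply/andP; split.
    rewrite (_ : p%:Z * (- B%:Z + 1) + d = p%:Z * - B%:Z + d + p%:Z); last by ring.
    by rewrite lerD2l lez_nat ltnW.
  by apply: le_trans d_lt _; rewrite oppr_le0.
apply: val_geW d_lt _; apply: val_geD => //.
by apply: val_geW wz1; rewrite lerDl.
Qed.

End BicyclicBreak.

(** * An element translated by a character *)

Section TranslationElement.
Variables (p : nat) (K : fieldType) (v : discrete_valuation K).
Hypotheses (charK : p \in [pchar K]) (p_gt2 : (2 < p)%N).
Hypothesis v_perfect : forall x, val_eq v 0 x -> exists k, val_ge v 1 (x - k ^+ p).
Variables (gT : finGroupType) (E : {group gT}) (N : {set gT}).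
Variables (M : splittingFieldType K) (w : discrete_valuation M).
Variables (phi : gT -> gal_of {:M}) (ram : gT -> nat) (bs : seq nat).
Hypothesis T : tower p v E N w phi ram bs.

Let D := \dim {:M}.
Let pr_p : prime p. Proof. by case/andP: charK. Qed.
Let charM : p \in [pchar M]. Proof. by rewrite pchar_lalg. Qed.
Let d0 : (0 < D)%N. Proof. exact: (tower_dim_gt0 charK T). Qed.
Let algX (k : K) n : (k ^+ n)%:A = k%:A ^+ n :> M.
Proof. exact: (rmorphXn (in_alg M)). Qed.
Let algM (k l : K) : (k * l)%:A = k%:A * l%:A :> M.
Proof. exact: (rmorphM (in_alg M)). Qed.
Let algD (k l : K) : (k + l)%:A = k%:A + l%:A :> M.
Proof. exact: (rmorphD (in_alg M)). Qed.

(** While [M : K] divides w(x), some element of K has the same leading term and can be subtracted,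
    since the residue field is that of K. The process stops before valuation 1: there e would move
    the element by a non-unit, but the differences phi e x - x never change. *)
Lemma translation_reduce x e : e \in E -> val_eq w 0 (phi e x - x) ->
  exists k : K, let x' := x - k%:A in w x' < 0 /\ ~~ (D%:Z %| w x')%Z.
Proof.
move=> Ee wx; have nNe : e \in E :\: N.
  rewrite inE Ee andbT; apply: contraL wx => Ne.
  by rewrite (cover_ker_id T) // subrr /val_eq eqxx.
suff [k kP] : exists k : K, ~~ (D%:Z %| w (x - k%:A))%Z.
  exists k; split=> //; rewrite ltNge; apply/negP => ge0.
  have w0 : w (x - k%:A) != 0 by apply: contraNneq kP => ->; apply: dvdz0.
  have wx' : val_ge w 1 (x - k%:A).
    by apply: val_geW (val_ge_val w _); rewrite -gtz0_ge1 lt_def w0.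
  have := tower_ram_ge T nNe wx'; rewrite rmorphB /= rmorph_alg.
  rewrite (_ : _ - _ - _ = phi e x - x); last by ring.
  by rewrite (val_eqE_ge _ wx).
have [n] : exists n : nat, val_ge w (1 - n%:Z) x.
  by exists (absz (1 - w x)); apply: val_geW (val_ge_val w x); move: (w x); clear; lia.
elim: n => [|n IHn] in x wx *; rewrite ?subr0 => wxn.
  by have := tower_ram_ge T nNe wxn; rewrite (val_eqE_ge _ wx).
have x0 : x != 0.
  by apply: contraTneq wx => ->; rewrite rmorph0 subrr /val_eq eqxx.
have [/dvdzP[q Dq]|ndvd] := boolP (D%:Z %| w x)%Z; last first.
  by exists 0; rewrite scale0r subr0.
have [c vc] := uniformizer_exp v q; have wc := tower_val_eq T vc.
have wu : val_eq w 0 (x / c%:A).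
  by have := val_eqM (val_eq_val w x0) (val_eqV wc); rewrite -/D Dq subrr.
have [k wk] := tower_residue T wu.
have cA0 := val_eq_neq0 wc.
have wx1 : val_ge w (w x + 1) (x - (c * k)%:A).
  rewrite algM; have -> : x - c%:A * k%:A = c%:A * (x / c%:A - k%:A).
    by rewrite mulrBr mulrCA divff ?mulr1.
  by rewrite Dq; apply: val_geM wk; apply: val_ge_eq.
have [||l lP] := IHn (x - (c * k)%:A).
- by rewrite rmorphB /= rmorph_alg (_ : _ - _ - _ = phi e x - x) //; ring.
- apply: val_geW wx1; move: wxn; rewrite (val_eqE_ge _ (val_eq_val w x0)).
  move: (w x) => W; clear; lia.
by exists (c * k + l); rewrite algD opprD addrA.
Qed.

(** If x = z^p, then e(z) - z and e(x) - x are equal, having the same p-th power; so z - x lies in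
    K. But w(x) = p w(z) < w(z), so z - x has the valuation of x, which is then divisible by
    [M : K]. *)
Lemma translation_non_power x : x != 0 -> w x < 0 -> ~~ (D%:Z %| w x)%Z ->
  {in E, forall e, (phi e x - x) ^+ p = phi e x - x} -> forall z, x != z ^+ p.
Proof.
move=> x0 wx_lt0 ndvd xE z; apply: contraNneq ndvd => Dx.
have p1 := prime_gt1 pr_p.
have charI : injective (fun y : M => y ^+ p).
  move=> y1 y2 /= Ey; apply/eqP; rewrite -subr_eq0; apply: contraT => y0.
  by have := expf_neq0 p y0; rewrite (FrobB charM) Ey subrr eqxx.
have zE : exists k : K, z - x = k%:A.
  apply: (cover_fixed T) => e Ee; have := xE e Ee.
  have -> : phi e x - x = (phi e z - z) ^+ p.
    by rewrite (FrobB charM) {1 2}Dx; congr (_ - _); exact: rmorphXn.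
  move/charI => Exz; apply/eqP; rewrite -subr_eq0 rmorphB /=.
  have -> : phi e z - phi e x - (z - x) = (phi e z - z) - (phi e x - x) by ring.
  rewrite -{1}Exz (FrobB charM) {1 2}Dx.
  have -> : phi e (z ^+ p) = phi e z ^+ p by exact: rmorphXn.
  by rewrite subrr.
have [k Dk] := zE.
have z0 : z != 0.
  by apply: contraNneq x0 => z0; rewrite Dx z0 expr0n gtn_eqF ?(ltnW p1).
have wx := val_eq_val w x0.
have lt_w : w x < w z.
  have := val_eqX p (val_eq_val w z0); rewrite -Dx => /val_eqK Ew.
  by move: wx_lt0; rewrite Ew; clear -p1; nia.
have wk : val_eq w (w x) k%:A.
  rewrite -Dk addrC val_eqD ?val_eqN //.
  by rewrite (val_eqE_ge _ (val_eq_val w z0)) lezD1.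
have k0 : k != 0 by have := val_eq_neq0 wk; rewrite scaler_eq0 oner_eq0 orbF.
rewrite (val_eq_inj wk (tower_val_eq T (val_eq_val v k0))).
exact: dvdz_mull.
Qed.

(** If p does not divide w(x), take z = 0 and rho = x; then w(x) + w(rho) = 2 w(x) and p is odd.
    Otherwise [nonpower_approx] gives rho, necessarily with w(rho) > w(x), and z^p + x = 2 x -
    rho. *)
Lemma translation_decomposition x : x != 0 -> w x < 0 -> (forall z, x != z ^+ p) ->
  exists z rho, [/\ x = z ^+ p + rho, rho != 0 /\ ~~ (p%:Z %| w rho)%Z,
    ~~ (p%:Z %| w x + w rho)%Z & val_eq w (w x) (z ^+ p + x)].
Proof.
move=> x0 wx_lt0 xP; have p1 := prime_gt1 pr_p.
have wx := val_eq_val w x0; have [pwx|pwx] := boolP (p%:Z %| w x)%Z; last first.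
  exists 0, x; rewrite expr0n gtn_eqF ?(ltnW p1) // !add0r; split=> //.
  rewrite -mulr2n -mulr_natl natz Gauss_dvdzr //.
  by rewrite coprimezE /= prime_coprime // gtnNdvd.
have [z pz] := nonpower_approx charM (tower_perfect charK v_perfect T) (tower_complete T) xP.
set rho := _ - _ in pz; have rho0 : rho != 0 by rewrite subr_eq0.
have Dx : x = z ^+ p + rho by rewrite /rho addrC subrK.
have wrho := val_eq_val w rho0.
have lt_w : w x < w rho.
  rewrite ltNge le_eqVlt; apply/negP => /orP[/eqP Ew|lt].
    by rewrite Ew pwx in pz.
  have wzp : val_eq w (w rho) (z ^+ p).
    rewrite -[z ^+ p](addrK rho) -Dx addrC val_eqD ?val_eqN //.
    by rewrite (val_eqE_ge _ wx) lezD1.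
  have z0 : z != 0.
    by apply: contraTneq wzp => ->; rewrite expr0n gtn_eqF ?(ltnW p1) // /val_eq eqxx.
  move: pz; rewrite (val_eq_inj wzp (val_eqX p (val_eq_val w z0))).
  by rewrite dvdz_mulr.
exists z, rho; split=> //.
  by apply: contra pz => /rpredB/(_ pwx); rewrite addrAC subrr add0r.
have -> : z ^+ p + x = 2%:R * x - rho by rewrite /rho; ring.
rewrite val_eqD //; first by rewrite -[w x]add0r val_eqM // (val_eq_nat charM) // gtnNdvd.
by rewrite val_geN (val_eqE_ge _ wrho) lezD1.
Qed.

(* Since x = z^p + rho, the element c^p (x^p - x) is congruent to - c^p rho
   modulo the u^p - u, up to terms of larger valuation when v(c) is very
   negative; likewise c^p ((x^p - x) x + (x^p - x)^2 / 2) is congruent to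
   - c^p rho (z^p + x) / 2. *)
Lemma translation_breaks x (al : K) b0 : x != 0 -> w x < 0 -> (forall z, x != z ^+ p) ->
  x ^+ p - x = al%:A ->
  exists (c : K) (u u2 : M) (b n : nat),
  [/\ [/\ (0 < b)%N, ~~ (p %| b)%N & all (fun i => (i <= b)%N) bs],
      (0 < n)%N /\ w x = - n%:Z, ~~ (p %| b + n)%N,
      val_eq w (- b%:Z) ((c ^+ p * al)%:A - (u ^+ p - u)) &
      val_eq w (- (b + n)%N%:Z)
        (b0 + (c ^+ p * al)%:A * x + (c ^+ p * al ^+ 2 / 2%:R)%:A - (u2 ^+ p - u2))].
Proof.
move=> x0 wx_lt0 xP x_root; have p1 := prime_gt1 pr_p.
have [z [rho [Dx [rho0 prho] pxrho w_zx]]] := translation_decomposition x0 wx_lt0 xP.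
have wrho := val_eq_val w rho0.
(* The p-th power of C q cancels the terms in x^(2p), since h = 1/2 lies in F_p. *)
pose h : K := 2%:R^-1; pose q := h%:A * (x ^+ 2 - z ^+ 2).
have p2 : ~~ (p %| 2)%N by rewrite gtnNdvd.
have h2 : 2%:R * h%:A = 1 :> M.
  by rewrite -[2%:R](rmorph_nat (in_alg M)) /= -algM divff ?scale1r // (natr_neq0 charK).
have hp : h%:A ^+ p = h%:A :> M.
  by rewrite -algX /h exprVn (Frob_nat charK).
have wh : val_eq w 0 (h%:A : M).
  apply: (val_eq_Frob _ p1) hp; apply: contraTneq (oner_neq0 M) => h0.
  by rewrite -h2 h0 mulr0 eqxx.
pose r := (absz (w rho) + absz (w (x - z)) + absz (w q) + absz (w b0) + sumn bs).+1.
have r_gt : (absz (w rho) + absz (w (x - z)%R) + absz (w q) + absz (w b0) + sumn bs < r)%N by [].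
clearbody r; have [c vc] := uniformizer_exp v (- r%:Z).
pose X := (r * D)%N; have rX : (r <= X)%N by rewrite leq_pmulr.
pose C : M := c%:A.
have wC : val_eq w (- X%:Z) C.
  by have := tower_val_eq T vc; rewrite -/D mulNr -PoszM.
have pX : (2 * X <= p * X)%N by rewrite leq_mul2r p1 orbT.
pose b := absz (p%:Z * X%:Z - w rho)%R; pose n := absz (w x).
have Dn : w x = - n%:Z by rewrite /n ltz0_abs ?opprK.
have Db : b%:Z = p%:Z * X%:Z - w rho.
  by rewrite /b; clear -rX pX r_gt; clearbody X; lia.
have [b_gt z_gt q_gt b0_gt] : [/\ (sumn bs < b)%N, - b%:Z + 1 <= - X%:Z + w (x - z),
    - (b + n)%N%:Z + 1 <= - X%:Z + w q & - (b + n)%N%:Z + 1 <= w b0].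
  by move: (b) (n) Db => b' n' Db; clear -Db rX pX r_gt; clearbody X; split; lia.
have Drho : rho = x - z ^+ p by rewrite Dx addrAC subrr add0r.
have algC2 : (c ^+ p * al)%:A = C ^+ p * (x ^+ p - x) by rewrite algM algX x_root.
have algC3 : (c ^+ p * al ^+ 2 / 2%:R)%:A = C ^+ p * (x ^+ p - x) ^+ 2 * h%:A.
  by rewrite !algM !algX x_root.
exists c, (C * (x - z)), (C * q), b, n; split.
- split; first exact: leq_ltn_trans b_gt.
    apply: contra prho => pb; rewrite (_ : w rho = p%:Z * X%:Z - b%:Z); last first.
      by rewrite Db opprB addrC subrK.
    by rewrite rpredB // dvdz_mulr.
  by apply/allP=> i /mem_leq_sumn/leq_trans; apply; apply: ltnW.
- by split=> //; rewrite -ltz_nat -oppr_lt0 -Dn.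
- apply: contra pxrho => pb; rewrite (_ : w x + w rho = p%:Z * X%:Z - (b + n)%N%:Z).
    by rewrite rpredB // dvdz_mulr.
  by rewrite PoszD Db Dn; ring.
- rewrite algC2 (_ : _ - _ = - (C ^+ p * rho) + C * (x - z)).
    rewrite val_eqD ?val_eqN //.
      by rewrite Db (_ : - _ = p%:Z * - X%:Z + w rho) ?val_eqM ?val_eqX //; ring.
    exact: val_geW z_gt (val_geM (val_ge_eq wC) (val_ge_val w _)).
  by rewrite exprMn (FrobB charM) Drho; ring.
rewrite algC2 algC3 (_ : _ - _ = - (C ^+ p * (rho * (h%:A * (z ^+ p + x)))) + (b0 + C * q)).
  rewrite val_eqD ?val_eqN //.
    rewrite PoszD Db (_ : - _ = p%:Z * - X%:Z + (w rho + (0 + w x))).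
      by rewrite !val_eqM // val_eqX.
    by rewrite Dn; ring.
  apply: val_geD; first exact: val_geW b0_gt (val_ge_val w _).
  exact: val_geW q_gt (val_geM (val_ge_eq wC) (val_ge_val w _)).
rewrite exprMn /q exprMn hp (FrobB charM) -!exprM !(mulnC 2) !exprM Drho.
have -> : C ^+ p * (x ^+ p - x) * x = C ^+ p * (x ^+ p - x) * x * (2%:R * h%:A).
  by rewrite h2 mulr1.
ring.
Qed.

End TranslationElement.

(** * Nonabelian p-groups *)

Section SpecialGroup.
Local Open Scope group_scope.
Variables (p : nat) (gT : finGroupType) (H H0 C : {group gT}) (x1 : gT).
Hypotheses (pr_p : prime p) (nH0 : H0 <| H) (iH0 : #|H : H0| = p).
Hypotheses (sCH0 : C \subset H0) (nCH : C <| H) (cCH : C \subset 'C(H)).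
Hypotheses (Hx1 : x1 \in H) (nx1 : x1 \notin H0) (ox1 : x1 ^+ p = 1).
Hypothesis comC : {in H, forall e, [~ e, x1] \in C}.

(** N1 = C <x1>, normal because x1 is central modulo C: all commutators [e, x1] lie in C. *)
Lemma special_normal_cycle : exists N1 : {group gT},
  [/\ N1 <| H, x1 \in N1, C \subset N1 & {in N1, forall n, exists i, n * x1 ^- i \in C}].
Proof.
have nCx1 : x1 \in 'N(C) := subsetP (normal_norm nCH) x1 Hx1.
exists (coset C @*^-1 <[coset C x1]>)%G; split.
- rewrite -(quotientGK nCH) cosetpre_normal; apply: sub_center_normal.
  rewrite cycle_subG; apply/setIP; split; first exact: mem_quotient.
  apply/centP => _ /morphimP[e nCe He ->]; apply/commute_sym/commgP.
  by rewrite -morphR //=; apply/eqP/coset_id/comC.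
- by rewrite mem_morphpre //= cycle_id.
- exact: sub_cosetpre.
move=> n /morphpreP[nCn /= /cycleP[i Dn]]; exists i; apply: coset_idr.
  by rewrite groupM ?groupV ?groupX.
rewrite (morphM (coset_morphism C)) ?groupV ?groupX //= (morphV (coset_morphism C)) ?groupX //=.
by rewrite (morphX (coset_morphism C)) //= Dn mulgV.
Qed.

Lemma special_commg_mul e e' : e \in H -> e' \in H ->
  [~ e * e', x1] = [~ e, x1] * [~ e', x1].
Proof.
move=> He He'; rewrite commMgJ; congr (_ * _); apply/conjg_fixP/commgP.
exact: (centsP cCH) (comC He) _ He'.
Qed.

Lemma special_commgX e i : e \in H -> [~ e, x1 ^+ i] = [~ e, x1] ^+ i.
Proof.
move=> He; rewrite commgX //; apply: commute_sym.
exact: (centsP cCH) (comC He) _ Hx1.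
Qed.

Lemma special_commg1 n i : n * x1 ^- i \in C -> [~ n, x1] = 1.
Proof.
move=> Cn; apply/eqP/commgP; rewrite -(mulgKV (x1 ^+ i) n).
apply: commute_sym; apply: commuteM; last exact: commuteX.
exact/commute_sym/((centsP cCH) _ Cn _ Hx1).
Qed.

End SpecialGroup.

(** * Realizing the special quotient with controlled breaks *)

Section SpecialRealization.
Variables (p : nat) (K : fieldType) (v : discrete_valuation K).
Hypotheses (charK : p \in [pchar K]) (p_gt2 : (2 < p)%N) (vC : val_complete v).
Hypothesis v_perfect : forall x, val_eq v 0 x -> exists k, val_ge v 1 (x - k ^+ p).
Variables (gT : finGroupType) (H H0 C : {group gT}) (x1 : gT).
Hypotheses (pH : (p.-group H)%g) (nH0 : (H0 <| H)%g) (iH0 : #|H : H0|%g = p).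
Hypotheses (sCH0 : C \subset H0) (nCH : (C <| H)%g) (cCH : C \subset ('C(H))%g).
Hypotheses (cardC : #|C| = p) (Hx1 : x1 \in H) (nx1 : x1 \notin H0).
Hypotheses (ox1 : (x1 ^+ p = 1)%g) (comC : {in H, forall e, [~ e, x1]%g \in C}).
Hypothesis ncx1 : exists2 e, e \in H & [~ e, x1]%g != 1%g.

Lemma special_realizable : exists (bs : seq nat) (b n : nat),
  ~~ (p ^ size bs %| n)%N /\ realizable p v H 1%g (bs ++ [:: b; b + p * n])%N.
Proof.
have /andP[pr_p _] := charK; have p1 := prime_gt1 pr_p.
have sH0H := normal_sub nH0.
have [N1 [nN1H N1x1 sCN1 N1P]] := special_normal_cycle nCH Hx1 comC.
have comHH : ([~: H, H] \subset H0)%g.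
  rewrite -quotient_cents2 ?normal_norm // (sub_abelian_cent _ (subxx _)) //.
  by apply: cyclic_abelian; rewrite prime_cyclic // card_quotient ?normal_norm // iH0.
have [j [jM _ jH0 jP]] := central_step_character pr_p (normal_refl H) nH0 sH0H iH0 comHH Hx1 nx1.
(* The component of e in H0, from e = x1^(j e) hh(e). *)
pose hh e := (x1 ^- j e * e)%g.
have H0h e : e \in H -> hh e \in H0 by apply: jP.
have DN1 : H0 :&: N1 = C.
  apply/setP=> e; apply/setIP/idP => [[H0e N1e]|Ce]; last first.
    by rewrite (subsetP sCH0) ?(subsetP sCN1).
  have [i Ci] := N1P e N1e; have H0x1i : (x1 ^+ i \in H0)%g.
    by rewrite -groupV -(groupMl _ H0e) (subsetP sCH0).
  have jX k : j (x1 ^+ k)%g = (k * j x1)%N %[mod p].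
    elim: k => [|k IHk].
      by apply/eqP; rewrite mul0n eqn_mod_dvd // subn0 jH0 ?group1.
    by rewrite expgS jM ?groupX // -modnDmr IHk modnDmr mulSn.
  have : (p %| i * j x1)%N.
    by rewrite /dvdn -jX -/(dvdn p _) (jH0 _ (groupX i Hx1)).
  rewrite Euclid_dvdM // jH0 // (negbTE nx1) orbF => /dvdnP[k Dk].
  by move: Ci; rewrite Dk mulnC expgM ox1 expg1n invg1 mulg1.
have [bs] := realizable_chain charK v_perfect pH (realizable_trivial p H vC)
  (normal_refl H) nN1H (normal_sub nN1H).
rewrite cat0s => -[M [w [phi [ram T]]]].
have charM : p \in [pchar M] by rewrite pchar_lalg.
have phi_x1 k e y : e \in H -> phi (x1 ^- k * e)%g y = phi e y.
  move=> He; have N1k : (x1 ^- k)%g \in N1 by rewrite groupV groupX.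
  by rewrite (cover_act T) ?(subsetP (normal_sub nN1H) _ N1k) // (cover_ker_id T _ N1k).
(* Since x1 acts trivially on M, already H0 maps onto the Galois group, with kernel C. This gives a
   central embedding problem for H0, solved by a' and b'. *)
have cov0 : galois_cover H0 C phi.
  split=> //; first exact: (cover_galois T).
  - by move=> e e' He He'; rewrite (cover_morph T) ?(subsetP sH0H).
  - move=> e H0e; rewrite (cover_ker T) ?(subsetP sH0H) // -DN1 inE H0e.
    by [].
  move=> g; have [e He <-] := cover_surj T g; exists (hh e); first exact: H0h.
  by apply/eqP/gal_eqP => y _; rewrite phi_x1.
have nC0 : (C <| H0)%g by apply: normalS nCH.
have comC0 : ([~: C, H0] \subset (1%G : {group gT}))%g.
  by rewrite (commG1P _) ?sub1G // (subset_trans cCH) ?centS.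
have iC : #|C : 1%G|%g = p by rewrite indexg1.
have [a' [b' [[aM' a_AS'] aC' a_nat]]] :=
  cover_central_solution charK cov0 (normal1 H0) (sub1G C) iC comC0.
have a_fix c e : c \in C -> phi e (a' c) = a' c.
  by move=> Cc; have [k ->] := a_nat c Cc; rewrite rmorph_nat.
have a_FrobC c : c \in C -> a' c ^+ p = a' c.
  by move=> Cc; have [k ->] := a_nat c Cc; rewrite (Frob_nat charM).
have aMC c c' : c \in C -> c' \in H0 -> a' (c * c')%g = a' c + a' c'.
  by move=> Cc Hc'; have H0c := subsetP sCH0 c Cc; rewrite aM' // a_fix.
have a1 : a' 1%g = 0 by apply/eqP; rewrite aC' ?group1.
have aX c k : c \in C -> a' (c ^+ k)%g = k%:R * a' c.
  move=> Cc; elim: k => [|k IHk]; first by rewrite a1 mul0r.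
  by rewrite expgS aMC ?groupX ?(subsetP sCH0) // IHk -natr1 mulrDl mul1r addrC.
pose chi e := a' [~ e, x1]%g.
have chiM e e' : e \in H -> e' \in H -> chi (e * e')%g = chi e + chi e'.
  move=> He He'; rewrite /chi (special_commg_mul cCH comC) //.
  by rewrite aMC ?comC // (subsetP sCH0) // comC.
have chi_fix e e' : e \in H -> phi e' (chi e) = chi e by move=> He; rewrite a_fix ?comC.
have chi_Frob e : e \in H -> chi e ^+ p = chi e by move=> He; rewrite a_FrobC ?comC.
have chi_N1 e : e \in N1 -> chi e = 0.
  by case/N1P=> i Ci; rewrite /chi (special_commg1 cCH Hx1 Ci).
have chi_hh e : e \in H -> chi (hh e) = chi e.
  move=> He; rewrite chiM ?groupV ?groupX // chi_N1 ?add0r //.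
  by rewrite groupV groupX.
have [||x0 Dx0] := additive_Hilbert90 T (c := chi).
- by move=> e e' He He'; rewrite chiM // chi_fix.
- exact: chi_N1.
have [e0 He0 nce0] := ncx1.
have chi_e0 : val_eq w 0 (chi e0).
  by apply: (val_eq_Frob _ p1); rewrite ?a_FrobC ?comC // aC' ?comC // inE.
have red : val_eq w 0 (phi e0 x0 - x0) by rewrite -Dx0.
have [k [wx_lt0 ndvd]] := translation_reduce T He0 red.
set x := x0 - k%:A in wx_lt0 ndvd.
have Dx e : e \in H -> phi e x = x + chi e.
  by move=> He; rewrite Dx0 // /x rmorphB /= rmorph_alg; ring.
have x_neq0 : x != 0.
  apply: contraTneq chi_e0 => xx0; have := Dx e0 He0.
  by rewrite xx0 rmorph0 add0r => <-; rewrite /val_eq eqxx.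
have xP := translation_non_power charK T x_neq0 wx_lt0 ndvd.
have {}xP : forall z, x != z ^+ p.
  by apply: xP => e He; rewrite Dx // addrC addKr chi_Frob.
have [al x_root] : exists al : K, x ^+ p - x = al%:A.
  apply: (cover_fixed T) => e He; rewrite rmorphB rmorphXn /= Dx //.
  by rewrite (FrobD charM) chi_Frob //; ring.
have [c [u [u2 [b [n [[b_gt0 pb bs_b] [n_gt0 Dn] pbn wgam wbeta]]]]]] :=
  translation_breaks charK p_gt2 v_perfect T b' x_neq0 wx_lt0 xP x_root.
set k1 := c ^+ p * al in wgam wbeta; set k2 := (c ^+ p * _ / _) in wbeta.
set gam := _ - _ in wgam; set beta := _ - _ in wbeta.
pose psi e : M := (j e)%:R.
have Sol_psi : AS_solution p H phi psi k1%:A.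
  split=> [e e' He He'|e He].
    by rewrite /psi rmorph_nat -natrD; apply/(natr_eq_mod charM)/jM.
  by rewrite /psi (Frob_nat charM) rmorph_alg !subrr.
have [aM1 a_AS1] := AS_solution_sub charK T u Sol_psi.
set a1' := fun e => _ in aM1 a_AS1.
have a1N e : e \in N1 -> a1' e = psi e.
  by move=> Ne; rewrite /a1' (cover_ker_id T) // subrr subr0.
have a1_neq0 : exists2 z, z \in N1 & a1' z != 0.
  by exists x1; rewrite // a1N // (natr_neq0 charM) // jH0.
have [L [wL [phi1 [iota [y [T1 iotaK [y_root wy] [w_iota wge_iota] act1]]]]]] :=
  tower_step charK T b_gt0 pb wgam bs_b aM1 a_AS1 a1_neq0.
have charL : p \in [pchar L] by rewrite pchar_lalg.
have DC : [set e in N1 | a1' e == 0] = C.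
  apply/setP=> e; rewrite inE -DN1 inE andbC; have [Ne|//] := boolP (e \in N1); last first.
    by rewrite !andbF.
  by rewrite a1N // -(dvdn_pcharf charM) jH0 // (subsetP (normal_sub nN1H)).
rewrite DC in T1.
have phi1_iota e z : e \in H -> phi1 e (iota z) = iota (phi e z) by case/act1.
(* The break is visible on the reduced root y; undoing the reduction gives X, which H translates by
   psi with values in F_p. *)
pose X := y + iota u.
have phi1_X e : e \in H -> phi1 e X = X + iota (psi e).
  move=> He; rewrite rmorphD /= phi1_iota //; have [_ ->] := act1 e He.
  by rewrite /a1' /X rmorphB rmorphB /=; ring.
have X_root : X ^+ p - X = iota k1%:A.
  rewrite /X (FrobD charL) -rmorphXn /=.
  have -> : y ^+ p + iota (u ^+ p) - (y + iota u) = (y ^+ p - y) + iota (u ^+ p - u).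
    by rewrite rmorphB; ring.
  by rewrite y_root -rmorphD subrK.
(* [H = H0 ><| <x1>] acts on X through psi, and conjugation by x1 multiplies
   h in H0 by [~ h, x1], that is, changes a' by the character chi. *)
pose aL e := iota (a' (hh e)) + iota (chi e) * X.
pose bL := iota (b' + k1%:A * x + k2%:A).
have Sol_L : AS_solution p H phi1 aL bL.
  split=> [e e' He He'|e He].
    have H0e := H0h e He; have H0e' := H0h e' He'.
    (* Moving x1^(j e') across hh(e) produces the commutator [hh(e), x1]^(j e'). *)
    have Dh : hh (e * e')%g = (hh e * ([~ hh e, x1] ^+ j e' * hh e'))%g.
      rewrite -(special_commgX cCH Hx1 comC) ?(subsetP sH0H) // mulgA commgEl mulKVg.
      have -> : hh (e * e')%g = (x1 ^- (j e + j e') * (e * e'))%g.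
        congr ((_)^-1 * _)%g.
        by rewrite -(expg_mod (j (e * e')%g) ox1) jM // (expg_mod _ ox1).
      by rewrite /hh expgD invMg conjgE !mulgA mulgK.
    have Cc : [~ hh e, x1]%g \in C by rewrite comC // (subsetP sH0H).
    have Eh : a' (hh (e * e')%g) = phi e' (a' (hh e)) + (j e')%:R * chi e + a' (hh e').
      have Ccl : ([~ hh e, x1] ^+ j e')%g \in C by apply: groupX.
      have H0cl := subsetP sCH0 _ Ccl.
      rewrite Dh (aM' _ _ H0e (groupM H0cl H0e')) (cover_act cov0 _ H0cl H0e').
      rewrite (cover_ker_id cov0 _ Ccl) phi_x1 // (aMC _ _ Ccl H0e') (aX _ _ Cc).
      by rewrite -/(chi (hh e)) chi_hh // addrA.
    rewrite /aL Eh chiM // !rmorphD rmorphM /= rmorph_nat.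
    rewrite phi1_iota // rmorphM /= phi1_iota // chi_fix // phi1_X // rmorph_nat; ring.
  have H0e := H0h e He.
  have chip := chi_Frob e He.
  have Eb : phi e b' = phi (hh e) b' by rewrite phi_x1.
  have Ephi : phi e (b' + k1%:A * x + k2%:A) - (b' + k1%:A * x + k2%:A) =
      (phi (hh e) b' - b') + k1%:A * chi e.
    by rewrite !rmorphD rmorphM /= !rmorph_alg Dx // Eb; ring.
  rewrite /bL phi1_iota // -rmorphB Ephi.
  rewrite -a_AS' // /aL (FrobD charL) exprMn -!rmorphXn /= chip.
  rewrite rmorphD rmorphM rmorphB /= -X_root; ring.
have bBn : (b < b + n)%N by rewrite -addn1 leq_add2l.
have [z wz] := bicyclic_break charM (tower_perfect charK v_perfect T) w_iota wge_iota
  b_gt0 pb wgam y_root wy bBn pbn wbeta.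
(* The action was computed on the unreduced bL. The sum of u2, which reduces over M, and z, which
   reduces over L, brings it to the form with a visible break. *)
have [aM2 a_AS2] := AS_solution_sub charK T1 (iota u2 + z) Sol_L.
set a2 := fun e => _ in aM2 a_AS2.
pose B2 := (b + p * n)%N.
have DB2 : (p * (b + n) - p.-1 * b = B2)%N.
  rewrite /B2 mulnDr addnC -addnBA ?leq_mul2r ?leq_pred ?orbT // addnC.
  by rewrite -mulnBl -subn1 subKn ?mul1n // ltnW.
have wB2 : val_eq wL (- B2%:Z) (bL - ((iota u2 + z) ^+ p - (iota u2 + z))).
  rewrite -DB2; move: wz; congr (val_eq _ _ _).
  by rewrite (FrobD charL) /beta /bL rmorphB rmorphB rmorphXn /=; ring.
have B2_gt0 : (0 < B2)%N by rewrite addn_gt0 b_gt0.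
have pB2 : ~~ (p %| B2)%N by rewrite /B2 dvdn_addl ?dvdn_mulr.
have bs_B2 : all (fun i => (i <= B2)%N) (rcons bs b).
  rewrite all_rcons leq_addr /=; apply: sub_all bs_b => i /leq_trans; apply.
  exact: leq_addr.
have a2C e : e \in C -> a2 e = iota (a' e).
  move=> Ce; have Ne := subsetP sCN1 e Ce; have He := subsetP (normal_sub nCH) e Ce.
  rewrite /a2 (cover_ker_id T1) // subrr subr0 /aL chi_N1 // rmorph0 mul0r addr0.
  have : (p %| j e)%N by rewrite jH0 // (subsetP sCH0).
  by case/dvdnP=> q Dq; rewrite /hh Dq mulnC expgM ox1 expg1n invg1 mul1g.
have [z1 Cz1 nz1] := index_prime_subsetPn pr_p iC.
have a2_neq0 : exists2 z2, z2 \in C & a2 z2 != 0.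
  by exists z1; rewrite ?a2C // fmorph_eq0 aC'.
have [L2 [wL2 [phi2 [_ [_ [T2 _ _ _ _]]]]]] :=
  tower_step charK T1 B2_gt0 pB2 wB2 bs_B2 aM2 a_AS2 a2_neq0.
exists bs, b, n; split.
  by move: ndvd; rewrite Dn (tower_dim T) dvdzE abszN.
have DT : [set e in C | a2 e == 0] = [1 gT]%g.
  apply/setP=> e; rewrite !inE; have [Ce|nCe] := boolP (e \in C).
    by rewrite a2C // fmorph_eq0 aC' // inE.
  by symmetry; apply/negbTE; apply: contraNneq nCe => ->; apply: group1.
rewrite DT in T2; rewrite -(cat1s b) catA !cats1.
exists L2, wL2, phi2, (fun e => if e \in (C : {set gT}) then B2
  else if e \in (N1 : {set gT}) then b else ram e).
exact: T2.
Qed.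

End SpecialRealization.

Section SpecialQuotient.
Local Open Scope group_scope.
Variables (p : nat) (gT : finGroupType) (G : {group gT}).
Hypotheses (p_gt2 : (2 < p)%N) (pG : p.-group G).

Definition special_structure (rT : finGroupType) (H H0 C : {group rT}) (x1 : rT) : Prop :=
  [/\ [/\ p.-group H, H0 <| H, #|H : H0| = p & C \subset H0],
      [/\ C <| H, C \subset 'C(H) & #|C| = p],
      [/\ x1 \in H, x1 \notin H0 & x1 ^+ p = 1],
      {in H, forall e, [~ e, x1] \in C} & exists2 e, e \in H & [~ e, x1] != 1].

(* When every nontrivial normal subgroup contains the derived subgroup C, the
   group C has order p and is central.  An odd p-group with a unique subgroup
   of order p is cyclic, hence some x1 outside C has order p; it is not
   central, so it avoids the Frattini subgroup, which is central because
   p-th powers are. *)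
Lemma special_structure_of_minimal (rT : finGroupType) (H : {group rT}) :
  p.-group H -> ~~ abelian H ->
  (forall L : {group rT}, L <| H -> L :!=: 1 -> H^`(1) \subset L) ->
  exists (H0 C : {group rT}) (x1 : rT), special_structure H H0 C x1.
Proof.
move=> pH nabH minH; pose C := (H^`(1))%G.
have ntC : C :!=: 1 by apply: contra nabH => /eqP/commG1P.
have nCH : C <| H by apply: der_normal.
have sub_central (x : rT) : x \in 'Z(H) -> x != 1 -> H^`(1) \subset <[x]>.
  move=> Zx x1; apply: minH; last by rewrite cycle_eq1.
  by apply: sub_center_normal; rewrite cycle_subG.
have ntZ := meet_center_nil (pgroup_nil pH) nCH ntC.
have pZ : p.-group (C :&: 'Z(H)).
  by apply: pgroupS pH; rewrite subIset // normal_sub.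
have [pr_p pdiv _] := pgroup_pdiv pZ ntZ.
have [c /setIP[Cc Zc] oc] := Cauchy pr_p pdiv.
have order_p_neq1 (x : rT) : #[x] = p -> x != 1.
  by move=> ox; rewrite -order_gt1 ox prime_gt1.
have DC : C :=: <[c]>.
  by apply/eqP; rewrite eqEsubset cycle_subG Cc andbT sub_central ?order_p_neq1.
have cardC : #|C| = p by rewrite DC -orderE.
have cCH : C \subset 'C(H).
  by rewrite DC cycle_subG; case/setIP: Zc.
have [x1 [Hx1 ox1 nCx1]] : exists x, [/\ x \in H, #[x] = p & x \notin C].
  have [[x Hx] /andP[/eqP ox nCx]|no_x] :=
    pickP [pred x : subg_of H | (#[sgval x] == p) && (sgval x \notin C)].
    by exists x.
  have ntH : H :!=: 1 by apply: subG1_contra ntC; exact: normal_sub.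
  case/negP: nabH; apply: cyclic_abelian.
  have : #|'Ohm_1(H)| = p.
    rewrite -cardC; congr #|pred_of_set _|; apply/eqP; rewrite eqEsubset.
    rewrite (OhmE 1 pH) gen_subG; apply/andP; split; last first.
      rewrite DC cycle_subG mem_gen // !inE (subsetP (normal_sub nCH)) //=.
      by rewrite expn1 -oc expg_order.
    apply/subsetP=> x; rewrite !inE expn1 => /andP[Hx /eqP xp].
    have [->|x_neq1] := eqVneq x 1; first exact: group1.
    have ox : #[x] = p.
      by apply/prime_nt_dvdP; rewrite ?order_eq1 // order_dvdn xp.
    by apply: contraT => nCx; have := no_x (subg H x); rewrite /= subgK // ox eqxx nCx.
  move/(prime_Ohm1P pH ntH); rewrite (_ : (p == 2) = false) ?orbF //.
  by rewrite gtn_eqF.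
have nZx1 : x1 \notin 'Z(H).
  apply: contra nCx1 => Zx1; have sCx1 := sub_central _ Zx1 (order_p_neq1 _ ox1).
  have DC1 : C :=: <[x1]> by apply/eqP; rewrite eqEcard sCx1 cardC -orderE ox1 /=.
  by have := cycle_id x1; rewrite -DC1.
have comm_C e e' : e \in H -> e' \in H -> [~ e, e'] \in C by move=> *; apply: mem_commg.
have sPhiZ : 'Phi(H) \subset 'Z(H).
  rewrite (Phi_joing pH) join_subG; apply/andP; split.
    by rewrite subsetI normal_sub.
  rewrite (MhoE 1 pH) gen_subG; apply/subsetP=> _ /imsetP[x Hx ->]; rewrite expn1.
  apply/setIP; split; first exact: groupX.
  apply/centP=> e He; apply/commgP; have Cxe := comm_C _ _ Hx He.
  (* p-th powers are central: [x^p, e] = [x, e]^p = 1, as C is central of order p. *)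
  rewrite commXg; last by apply: commute_sym; apply: (centsP cCH) Cxe _ Hx.
  by apply/eqP; rewrite -cardC expg_cardG.
have [H0 maxH0 nx1] : exists2 H0 : {group rT}, maximal H0 H & x1 \notin H0.
  have nPhi : x1 \notin 'Phi(H) by apply: contra nZx1; apply: subsetP.
  have /existsP[H0 /andP[maxH0 nx1]] :
      [exists H0 : {group rT}, maximal H0 H && (x1 \notin H0)].
    apply: contraT; rewrite negb_exists => /forallP no_H0; case/negP: nPhi.
    apply/bigcapP=> L /orP[/eqP->|maxL] //.
    by have := no_H0 L; rewrite maxL negbK.
  by exists H0.
exists H0, C, x1; split; [split=> // | by split | split=> // | |].
- exact: (p_maximal_normal pH maxH0).
- exact: (p_maximal_index pH maxH0).
- apply: subset_trans (_ : 'Phi(H) \subset _).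
    by rewrite (Phi_joing pH) joing_subl.
  exact: Phi_sub_max.
- by rewrite -ox1 expg_order.
- by move=> e He; apply: (comm_C _ _ He Hx1).
have : ~~ (H \subset 'C[x1]).
  apply: contra nZx1 => sHC; apply/setIP; split=> //.
  by apply/centP=> e He; apply: commute_sym; apply/cent1P; apply: (subsetP sHC).
case/subsetPn=> e He nce; exists e => //.
by apply: contra nce => /commgP ce; apply/cent1P.
Qed.

(** N is maximal among the normal subgroups that do not contain the derived subgroup; a nontrivial
    normal subgroup of G / N pulls back to a larger one, which must contain it. *)
Lemma special_quotient : ~~ abelian G ->
  exists N : {group gT}, N <| G /\
    exists (H0 C : {group coset_of N}) (x1 : coset_of N), special_structure (G / N)%G H0 C x1.
Proof.
move=> nabG; pose P (N : {group gT}) := (N <| G) && ~~ (G^`(1) \subset N).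
have [|N /maxgroupP[/andP[nNG nsG'N] maxN]] := @ex_maxgroup _ P.
  exists 1%G; rewrite /P normal1; apply: contra nabG => /trivgP/commG1P.
  by [].
exists N; split=> //; apply: special_structure_of_minimal => [||L nLQ ntL].
- exact: quotient_pgroup.
- apply: contra nsG'N => abQ; apply: der1_min abQ; exact: normal_norm.
have sNL : N \subset coset N @*^-1 L by apply: sub_cosetpre.
have nLG : coset N @*^-1 L <| G by rewrite -(quotientGK nNG) cosetpre_normal.
have sG'L : G^`(1) \subset coset N @*^-1 L.
  apply: contraT => nsG'L; case/negP: ntL.
  have DN : coset N @*^-1 L = N by apply: (maxN (coset N @*^-1 L)%G); rewrite // /P nLG.
  by rewrite -(cosetpreK L) DN trivg_quotient.
by rewrite -quotient_der ?normal_norm // -(cosetpreK L) quotientS.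
Qed.

End SpecialQuotient.

(** * Ramification of the top of a tower *)

Section RealizedGroup.
Variables (p : nat) (K : fieldType) (v : discrete_valuation K).
Hypothesis charK : p \in [pchar K].

(** Inflation: G acts on the same field through G / N. The fibres of G over G / N are cosets, which
    accounts for the factor |N| in [tower_card_ram]. *)
Lemma realizable_quotient (gT : finGroupType) (G N : {group gT}) bs : (N <| G)%g ->
  realizable p v (G / N)%G 1%g bs -> realizable p v G N bs.
Proof.
move=> nNG [M [w [phi [ram T]]]]; have nNG' := subsetP (normal_norm nNG).
have Qe e : e \in G -> coset N e \in (G / N)%G by move=> Ge; apply: mem_quotient.
have ker e : e \in G -> (coset N e \in [1 coset_of N]%g) = (e \in N).
  move=> Ge; rewrite inE; apply/eqP/idP => [/coset_idr->//|/coset_id//].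
  exact: nNG'.
have ndQ e : e \in G :\: N -> coset N e \in (G / N)%G :\: [1 coset_of N]%g.
  by case/setDP=> Ge nNe; rewrite in_setD Qe // ker // nNe.
exists M, w, (fun e => phi (coset N e)), (fun e => ram (coset N e)); split.
- split=> [|||e Ge|g]; first exact: normal_sub.
  + exact: (cover_galois T).
  + by move=> e e' Ge Ge' /=; rewrite morphM ?nNG' // (cover_morph T) ?Qe.
  + by rewrite (cover_ker T) ?Qe // ker.
  have [_ /morphimP[e _ Ge ->] <-] := cover_surj T g; by exists e.
- exact: (tower_ramified T).
- exact: (tower_complete T).
- exact: (tower_residue T).
- by move=> e /ndQ; apply: (tower_ram_gt0 T).
- by move=> e /ndQ; apply: (tower_ram_ge T).
- by move=> e /ndQ; apply: (tower_ram_eq T).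
- move=> b; have := tower_card_ram T b; rewrite cards1 mul1n => <-.
  set A := [set e in G | _]; set A' := [set e in (G / N)%G | _].
  have AE e : e \in G -> (e \in A) = (coset N e \in A').
    by move=> Ge; rewrite [in LHS]inE [in RHS]inE Ge Qe // ker.
  rewrite -sum1_card (partition_big (coset N) (mem A')) /=; last first.
    by move=> e Ae; rewrite -AE //; move: Ae; rewrite inE => /andP[].
  rewrite mulnC -sum_nat_const; apply: eq_bigr => q A'q.
  have Qq : q \in (G / N)%g by move: A'q; rewrite inE => /andP[].
  have [x Nx Gx Dq] := morphimP Qq.
  rewrite sum1_card -(card_rcoset N x); apply: eq_card => e.
  rewrite -[LHS]/((e \in A) && (coset N e == q)); apply/andP/idP => [[Ae /eqP De]|].
    have Ge : e \in G by move: Ae; rewrite inE => /andP[].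
    by rewrite -(val_coset Nx) /= -Dq -De val_coset ?nNG' // rcoset_refl.
  move=> Nxe; have Ge : e \in G.
    by move: Nxe => /rcosetP[n Nn ->]; rewrite groupM // (subsetP (normal_sub nNG)).
  have De : coset N e = q.
    by rewrite Dq; apply/coset_mem; rewrite val_coset.
  by rewrite AE // De eqxx.
- exact: (tower_sorted T).
exact: (tower_breaks_gt0 T).
Qed.

Section TopTower.
Variables (gT : finGroupType) (G : {group gT}).
Variables (M : splittingFieldType K) (w : discrete_valuation M).
Variables (phi : gT -> gal_of {:M}) (ram : gT -> nat) (bs : seq nat).
Hypothesis T : tower p v G 1%g w phi ram bs.

Let f : {morphism G >-> gal_of {:M}} := Morphism (cover_morph T).

Lemma top_isog : 'Gal({:M} / 1)%g \isog G.
Proof.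
rewrite isog_sym; apply/isogP; exists f.
  apply/subsetP=> e /morphpreP[Ge /set1P De]; rewrite inE -(in_set1 e).
  by rewrite -(cover_ker T) // [phi e]De.
apply: etrans _ (esym (galT M)).
apply/setP=> g; rewrite inE; have [e Ge <-] := cover_surj T g.
exact: (mem_morphim f).
Qed.

(** The valuation 1 of a uniformizer is prime to p, so [tower_ram_eq] gives w(e(pi) - pi) = 1 + ram
    e; the 1 is removed in [ramif_i]. *)
Lemma top_ramif (pi : M) b : val_eq w 1 pi ->
  ramif_group w pi b%:Z = phi @: [set e in G | (e \in [1 gT]%g) || (b <= ram e)%N].
Proof.
move=> wpi; have /andP[pr_p _] := charK.
have p1 : ~~ (p%:Z %| 1)%Z by rewrite dvdz1 /= gtn_eqF ?prime_gt1.
apply/setP=> s; rewrite inE galT inE /=.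
have [e Ge <-] := cover_surj T s; rewrite (cover_ker T) //.
have phi_inj : {in G &, injective phi}.
  move=> e1 e2 G1 G2 E12; apply/eqP; rewrite eq_mulgV1 -in_set1.
  exact: (cover_phi_eq T).
have -> : (phi e \in phi @: [set e0 in G | (e0 \in [1 gT]%g) || (b <= ram e0)%N]) =
   (e \in [1 gT]%g) || (b <= ram e)%N.
  apply/imsetP/idP => [[e']|He]; last by exists e; rewrite // inE Ge.
  by rewrite inE => /andP[Ge' He'] /phi_inj-> .
have [//|ne1] := boolP (e \in [1 gT]%g); rewrite /= /ramif_i.
have ndE : e \in G :\: [1 gT]%g by rewrite inE ne1.
by rewrite (val_eqK (tower_ram_eq T ndE p1 wpi)) addrAC subrr add0r.
Qed.

Lemma top_ramif_card (pi : M) b : val_eq w 1 pi ->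
  #|ramif_group w pi b%:Z| = (p ^ count (leq b) bs)%N.
Proof.
move=> wpi; rewrite top_ramif // card_in_imset; last first.
  move=> e1 e2; rewrite !inE => /andP[G1 _] /andP[G2 _] E12.
  by apply/eqP; rewrite eq_mulgV1 -in_set1; apply: (cover_phi_eq T).
by rewrite (tower_card_ram T) cards1 mul1n.
Qed.

Lemma top_ramif_group (pi : M) b : val_eq w 1 pi -> group_set (ramif_group w pi b%:Z).
Proof.
move=> wpi; have w_act (g : gal_of {:M}) x n : val_ge w n x -> val_ge w n (g x).
  move=> wx; have [e Ge <-] := cover_surj T g.
  have [e1|ne1] := boolP (e \in [1 gT]%g); first by rewrite (cover_ker_id T).
  have ndE : e \in G :\: [1 gT]%g by rewrite inE ne1.
  rewrite -(subrK x (phi e x)) val_geD //.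
  by apply: val_geW (tower_ram_ge T ndE wx); rewrite lerDl.
have memE s : (s \in ramif_group w pi b%:Z) = val_ge w (b%:Z + 1) (s pi - pi).
  rewrite inE galT inE /=; have [->|s1] := eqVneq s 1%g.
    by rewrite gal_id subrr val_ge0r.
  have [e Ge De] := cover_surj T s.
  have ndE : e \in G :\: [1 gT]%g.
    by rewrite inE Ge andbT -(cover_ker T) // De.
  have /andP[pr_p _] := charK.
  have p1 : ~~ (p%:Z %| 1)%Z by rewrite dvdz1 /= gtn_eqF ?prime_gt1.
  have := tower_ram_eq T ndE p1 wpi; rewrite De => ws.
  by rewrite (val_eqE_ge _ ws) /ramif_i (val_eqK ws) lerBrDr.
apply/group_setP; split=> [|s t]; rewrite !memE ?gal_id ?subrr ?val_ge0r // => ws wt.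
rewrite galM ?memvf // -(subrK (t pi) (t (s pi))) -addrA val_geD //.
by rewrite -rmorphB w_act.
Qed.

Lemma top_lower_breaks (pi : M) : val_eq w 1 pi -> lower_breaks p w pi bs.
Proof.
move=> wpi; have /andP[pr_p _] := charK.
split; [exact: tower_sorted T | exact: tower_breaks_gt0 T | move=> b _].
pose A := Group (top_ramif_group b wpi); pose A' := Group (top_ramif_group b.+1 wpi).
have sub : A' \subset A.
  apply/subsetP=> s; rewrite !inE => /andP[-> /=]; case: eqP => //= _.
  by apply: le_trans; rewrite lez_nat.
have cnt : count (leq b) bs = (count_mem b bs + count (leq b.+1) bs)%N.
  elim: (bs) => //= i t ->; rewrite leq_eqVlt [i == b]eq_sym.
  case: (eqVneq b i) => [<-|_] /=; first by rewrite ltnn addnA.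
  by rewrite add0n addnCA.
have := divgS sub; rewrite /= !top_ramif_card // => <-.
by rewrite cnt expnD mulnK // expn_gt0 prime_gt0.
Qed.

Lemma top_tame : tame_degree p M = 1%N.
Proof.
have /andP[pr_p _] := charK.
rewrite /tame_degree (tower_dim T) part_p'nat // pnatNK pnatX pnat_id //.
Qed.

End TopTower.

End RealizedGroup.

Lemma positive_upper_break_prefix (p : nat) (K : fieldType) (L : splittingFieldType K)
    (bs : seq nat) (b c : nat) (s : seq nat) :
  positive_upper_break p L (bs ++ b :: c :: s) (size bs).+1 =
  positive_upper_break p L (bs ++ b :: c :: s) (size bs) +
    (c%:R - b%:R) / (tame_degree p L * p ^ (size bs).+1)%:R.
Proof.
by rewrite [LHS]/= !nth_cat ltnn ltnNge leqnSn /= subnn subSnn.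
Qed.

Lemma break_jump_dvd (p k b n : nat) : (0 < p)%N ->
  ((b + p * n)%N%:R - b%:R) / (p ^ k.+1)%:R \is a @Num.int rat -> (p ^ k %| n)%N.
Proof.
move=> p_gt0 /intrP[z Dz].
have p0 : p%:R != 0 :> rat by rewrite pnatr_eq0 -lt0n.
have {}Dz : n%:R = z%:~R * (p ^ k)%:R :> rat.
  apply: (mulfI p0); rewrite -natrM -[LHS](addrK b%:R) -natrD addnC mulrCA -natrM -expnS.
  by rewrite -Dz divfK // pnatr_eq0 -lt0n expn_gt0 p_gt0.
apply/(@dvdzP (p ^ k)%N%:Z n%:Z); exists z.
by apply: (@intr_inj rat); rewrite rmorphM.
Qed.

Theorem theorem5p5 (p : nat) (K : fieldType) (v : discrete_valuation K)
    (localK : local_field v) (charK : p \in [pchar K]) (p_gt2 : (2 < p)%N)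
    (gT : finGroupType) (G : {group gT})
    (pG : (p.-group G)%g) (nabelG : ~~ abelian G) :
  exists (L : splittingFieldType K) (w : discrete_valuation L),
    [/\ galois 1 {:L}, totally_ramified v w, 'Gal({:L} / 1)%g \isog G &
        exists2 u : rat, upper_break p w u & u \isn't a Num.int].
Proof.
have /andP[pr_p _] := charK; have [vC perf] := localK.
have v_perfect := residue_perfectP charK perf.
have [N [nNG [H0 [C [x1 [[pH nH0 iH0 sCH0] [nCH cCH cardC] [Hx1 nx1 ox1] comC ncx1]]]]]] :=
  special_quotient p_gt2 pG nabelG.
have [bs [b [n [ndvd rQ]]]] := special_realizable charK p_gt2 vC v_perfect pH nH0 iH0
  sCH0 nCH cCH cardC Hx1 nx1 ox1 comC ncx1.
have rN := realizable_quotient nNG rQ.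
have [s [L [w [phi [ram T]]]]] :=
  realizable_chain charK v_perfect pG rN nNG (normal1 G) (sub1G N).
exists L, w; split.
- exact: cover_galois T.
- exact: tower_ramified T.
- exact: top_isog T.
have [pi pi0 w_pi] := dval_surj w; have wpi : val_eq w 1 pi by rewrite /val_eq pi0 w_pi eqxx.
have breaks := top_lower_breaks charK T wpi.
(* The steps below N only append s, so b and b + p n keep their positions. *)
move: breaks; rewrite -catA /= => breaks; set bsf := _ ++ _ in breaks.
have is_break i : (i < size bsf)%N -> upper_break p w (positive_upper_break p L bsf i).
  by move=> lt_i; right; exists pi, bsf, i.
have sz : ((size bs).+1 < size bsf)%N by rewrite size_cat /= !addnS !ltnS leq_addr.
(* The two upper breaks differ by n / p^(size bs), which is not an integer, so at least one of them
   is not an integer. *)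
have [u_int|] := boolP (positive_upper_break p L bsf (size bs) \is a Num.int); last first.
  by exists (positive_upper_break p L bsf (size bs)) => //; apply/is_break/ltnW.
exists (positive_upper_break p L bsf (size bs).+1); first exact: is_break.
rewrite positive_upper_break_prefix rpredDl // (top_tame charK T) mul1n.
by apply: contra ndvd => /(break_jump_dvd (prime_gt0 pr_p)).
Qed.
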